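(* There exists a constant $M_0>0$, depending only on $\Omega$, $T$, $\sigma$ and the coefficients $a_{ij}$, $b_j$ ($1\le i,j\le d$), such that the following holds whenever $\min_{(x,t)\in\overline\Omega\times[0,T]}b_0(x,t)\ge M_0$. Let $F\in L^2(0,T;L^2(\Omega))$ and $a\in H^1(\Omega)$ satisfy $F(x,t)\ge0$ for $(x,t)\in\Omega\times(0,T)$ and $a(x)\ge0$ for $x\in\Omega$. Assume that there exists a solution $u\in C([0,T];C^2(\overline\Omega))$ to the initial-boundary value problem $$\begin{cases}\partial_t^\alpha(u-a)+A_1u=F(x,t), & x\in\Omega,\ 0<t<T,\\ \partial_{\nu_A}u+\sigma(x)u=0 & \text{on }\partial\Omega\times(0,T),\\ u(x,\cdot)-a(x)\in H_\alpha(0,T) & \text{for almost all }x\in\Omega,\end{cases}$$ and that $u$ satisfies $t^{1-\alpha}\partial_tu\in C([0,T];C(\overline\Omega))$. Then $u(x,t)\ge0$ for all $(x,t)\in\Omega\times(0,T)$.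
   Context: Throughout, $0<\alpha<1$, $T>0$, $d\in\{1,2,3\}$, $\Omega\subset\mathbb{R}^d$ is a bounded domain with smooth boundary $\partial\Omega$, $\nu=(\nu_1,\dots,\nu_d)$ is the unit outward normal to $\partial\Omega$, $\partial_j=\partial/\partial x_j$, and all functions are real-valued. Inequalities for $L^2$ data are understood almost everywhere. Fractional derivative. For $\beta>0$ let $(J^\beta f)(t)=\frac1{\Gamma(\beta)}\int_0^t(t-s)^{\beta-1}f(s)\,ds$, $0<t<T$. Let $H_\alpha(0,T)$ be the closure of $\{u\in C^1[0,T]: u(0)=0\}$ in the Sobolev-Slobodeckij space $H^\alpha(0,T)$ (for $\alpha=\frac12$: $H_{1/2}(0,T)=\{v\in H^{1/2}(0,T):\int_0^T\frac{|v(t)|^2}{t}dt<\infty\}$). It is known that $H_\alpha(0,T)=J^\alpha L^2(0,T)$. Define $\partial_t^\alpha:=(J^\alpha)^{-1}$ with domain $H_\alpha(0,T)$; it is applied to functions of $(x,t)$ in the variable $t$. Operator and coefficients. $$(-A_1v)(x,t)=\sum_{i,j=1}^d\partial_i(a_{ij}(x)\partial_jv)+\sum_{j=1}^db_j(x,t)\partial_jv-b_0(x,t)v,$$ where $a_{ij}=a_{ji}\in C^1(\overline\Omega)$ for $1\le i,j\le d$; $b_j\in C^1([0,T];C^1(\overline\Omega))\cap C([0,T];C^2(\overline\Omega))$ for $0\le j\le d$; $b_0>0$ on $\overline\Omega\times[0,T]$; and there is a constant $\kappa>0$ with $\sum_{i,j=1}^da_{ij}(x)\xi_i\xi_j\ge\kappa\sum_{j=1}^d\xi_j^2$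 for all $x\in\Omega$, $\xi_1,\dots,\xi_d\in\mathbb{R}$. The conormal derivative is $\partial_{\nu_A}w(x)=\sum_{i,j=1}^da_{ij}(x)\,\partial_jw(x)\,\nu_i(x)$, $x\in\partial\Omega$, and $\sigma$ is a smooth function on $\partial\Omega$ with $\sigma\ge0$. *)

(* Defs.v *)
From HB Require Import structures.
From mathcomp Require Import all_boot all_order all_algebra.
From mathcomp Require Import all_classical all_reals all_analysis.

Set Implicit Arguments.
Unset Strict Implicit.
Unset Printing Implicit Defensive.

Import Order.TTheory GRing.Theory Num.Theory.
Import numFieldNormedType.Exports.

Local Open Scope classical_set_scope.
Local Open Scope ring_scope.

Definition rV_display : measure_display. Proof. exact: default_measure_display. Qed.

Section rV_measurable.
Context (R : realType) (n : nat).

Let coors : 'I_n -> 'rV[R]_n -> R := fun i x => x ord0 i.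

Let rV_set0 : g_sigma_preimage coors set0.
Proof. exact: sigma_algebra0. Qed.

Let rV_setC A : g_sigma_preimage coors A -> g_sigma_preimage coors (~` A).
Proof. exact: sigma_algebraC. Qed.

Let rV_bigcup (F : (set 'rV[R]_n)^nat) :
  (forall i, g_sigma_preimage coors (F i)) ->
  g_sigma_preimage coors (\bigcup_i (F i)).
Proof. exact: sigma_algebra_bigcup. Qed.

HB.instance Definition _ := @isMeasurable.Build rV_display
  'rV[R]_n (g_sigma_preimage coors) rV_set0 rV_setC rV_bigcup.

End rV_measurable.

Section lebesgue_rV.
Context (R : realType).

Definition rV_cons n (p : 'rV[R]_n * R) : 'rV[R]_n.+1 :=
  row_mx (p.2%:M : 'rV_1) p.1.

Lemma measurable_coord n (i : 'I_n) :
  measurable_fun [set: 'rV[R]_n] (fun x : 'rV[R]_n => x ord0 i).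
Proof.
move=> _ Y mY; rewrite setTI; apply: sub_sigma_algebra => /=.
rewrite -bigcup_seq/=; exists i => /=; first by rewrite mem_index_enum.
by exists Y => //; rewrite setTI.
Qed.

Lemma measurable_rV_cons n : measurable_fun [set: 'rV[R]_n * R] (@rV_cons n).
Proof.
have mc (i : 'I_n.+1) :
    measurable_fun [set: 'rV[R]_n * R] (fun p => rV_cons p ord0 i).
  have [j ->|->] := unliftP ord0 i.
    rewrite (_ : (fun _ => _) = (fun x : 'rV[R]_n => x ord0 j) \o fst).
      by apply: measurableT_comp => //; exact: measurable_coord.
    apply/funext => p /=.
    rewrite (_ : lift ord0 j = rshift 1 j :> 'I_(1 + n)); last exact/val_inj.
    exact: (row_mxEr (p.2%:M : 'rV_1)).
  rewrite (_ : (fun _ => _) = snd) //; apply/funext => p.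
  rewrite (_ : ord0 = lshift n ord0 :> 'I_(1 + n)); last exact/val_inj.
  by rewrite [LHS](row_mxEl (p.2%:M : 'rV_1)) mxE eqxx mulr1n.
move=> _ Y mY; rewrite setTI.
suff : preimage_set_system setT (@rV_cons n) measurable `<=` measurable.
  by apply; exists Y => //; rewrite setTI.
rewrite [X in preimage_set_system _ _ X](_ : _ =
    g_sigma_preimage (fun i (x : 'rV[R]_n.+1) => x ord0 i)) //.
rewrite -g_sigma_preimage_comp; apply: smallest_sub.
  exact: sigma_algebra_measurable.
rewrite -bigcup_seq; apply: bigcup_sub => i _ A [B mB <-].
exact: mc.
Qed.


(* Lebesgue measure on R^n, as an iterated product of the one-dimensional one. *)
Fixpoint lebesgue_rV n : {measure set 'rV[R]_n -> \bar R} :=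
  match n with
  | 0 => \d_ (0 : 'rV[R]_0)
  | n'.+1 => measure_function_pushforward__canonical__measure_function_Measure
      (lebesgue_rV n' \x lebesgue_measure)%E (@measurable_rV_cons n')
  end.

Lemma lebesgue_rVS n (X : set 'rV[R]_n.+1) :
  lebesgue_rV n.+1 X =
  (lebesgue_rV n \x lebesgue_measure)%E (@rV_cons n @^-1` X).
Proof. by []. Qed.

End lebesgue_rV.

Section calculus.
Context (R : realType) (d : nat).
Implicit Types (Omega U : set 'rV[R]_d) (f : 'rV[R]_d -> R).

Definition basis_vec (i : 'I_d) : 'rV[R]_d := delta_mx ord0 i.

Definition pder (i : 'I_d) f : 'rV[R]_d -> R := fun x => 'D_(basis_vec i) f x.

(* The list s encodes a multi-index: pders [:: i; j] f is d_i (d_j f). *)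
Definition pders (s : seq 'I_d) f : 'rV[R]_d -> R := foldr pder f s.

Definition grad f (x : 'rV[R]_d) : 'rV[R]_d := \row_i pder i f x.

(* The norm of the library on 'rV[R]_d is the sup norm. *)
Definition euclid_norm (v : 'rV[R]_d) : R := Num.sqrt (\sum_i v ord0 i ^+ 2).

(* f is C^infinity on the open set U *)
Definition smooth_on U f := forall (s : seq 'I_d) x, U x ->
  {for x, continuous (pders s f)} /\
  forall i, derivable (pders s f) x (basis_vec i).

Definition boundary Omega : set 'rV[R]_d := closure Omega `\` Omega°.

(* phi is a smooth defining function of Omega near p: Omega lies locally on
   the side phi < 0 of the smooth hypersurface phi = 0 *)
Definition defining_function Omega (p : 'rV[R]_d) U (phi : 'rV[R]_d -> R) :=
  [/\ open U, U p, smooth_on U phi,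
      forall x, U x -> grad phi x != 0 &
      forall x, U x -> (Omega x <-> phi x < 0)].

Definition smooth_boundary Omega := forall p, boundary Omega p ->
  exists U phi, defining_function Omega p U phi.

Definition smooth_bounded_domain Omega :=
  [/\ Omega !=set0, open Omega, connected Omega, bounded_set Omega &
      smooth_boundary Omega].

Definition outward_unit_normal Omega (nu : 'rV[R]_d -> 'rV[R]_d) :=
  forall p, boundary Omega p -> exists U phi,
    defining_function Omega p U phi /\
    nu p = (euclid_norm (grad phi p))^-1 *: grad phi p.

(* A function on the boundary is smooth when it is locally the restriction of
   a smooth function defined on an open set. *)
Definition smooth_on_boundary Omega (sigma : 'rV[R]_d -> R) :=
  forall p, boundary Omega p -> exists U g,
    [/\ open U, U p, smooth_on U g &
        forall x, U x -> boundary Omega x -> sigma x = g x].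

(* C^k(closure Omega): the partial derivatives of order at most k exist in
   Omega and extend continuously to the closure. *)
Definition Ck_closure (k : nat) Omega f :=
  {within closure Omega, continuous f} /\
  forall s : seq 'I_d, (size s <= k)%N ->
    ((size s < k)%N ->
      forall i x, Omega x -> derivable (pders s f) x (basis_vec i)) /\
    exists2 g : 'rV[R]_d -> R, {within closure Omega, continuous g} &
      forall x, Omega x -> g x = pders s f x.

(* The norm of C^k(closure Omega); by continuity the suprema over Omega and
   over its closure agree. *)
Definition Ck_norm (k : nat) Omega f : R :=
  sup [set r | exists s : seq 'I_d, exists x,
    [/\ (size s <= k)%N, Omega x & r = `|pders s f x|]].

(* d_i f at a point x of the closure of Omega, read off from inside Omega *)
Definition pder_closure Omega (i : 'I_d) f (x : 'rV[R]_d) : R :=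
  lim (pder i f y @[y --> within Omega (nbhs x)]).

(* C([0,T]; C^k(closure Omega)) *)
Definition C0t_Ck (T : R) (k : nat) Omega (w : 'rV[R]_d -> R -> R) :=
  forall t, t \in `[0, T] -> Ck_closure k Omega (w^~ t) /\
    Ck_norm k Omega (fun x => w x s - w x t)
      @[s --> within `[0, T] (nbhs t)] --> (0 : R).

(* C^1([0,T]; C^k(closure Omega)); w' is the derivative for the C^k norm *)
Definition C1t_Ck (T : R) (k : nat) Omega (w : 'rV[R]_d -> R -> R) :=
  C0t_Ck T k Omega w /\
  exists2 w' : 'rV[R]_d -> R -> R, C0t_Ck T k Omega w' &
    forall t, t \in `[0, T] ->
      Ck_norm k Omega (fun x => (w x s - w x t) / (s - t) - w' x t)
        @[s --> within `[0, T] (dnbhs t)] --> (0 : R).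

End calculus.

Section lebesgue_sobolev.
Context (R : realType).

(* Square integrable functions, as Borel measurable representatives. *)
Definition L2 disp (X : measurableType disp) (m : set X -> \bar R) (D : set X)
  (f : X -> R) :=
  measurable_fun D f /\ m.-integrable D (fun x => (f x ^+ 2)%:E).

Definition test_function (d : nat) (Omega : set 'rV[R]_d)
  (phi : 'rV[R]_d -> R) :=
  smooth_on setT phi /\
  exists K : set 'rV[R]_d,
    [/\ compact K, K `<=` Omega & forall x, ~ K x -> phi x = 0].

Definition sobolev_H1 (d : nat) (Omega : set 'rV[R]_d) (f : 'rV[R]_d -> R) :=
  L2 (lebesgue_rV R d) Omega f /\
  forall i : 'I_d, exists2 g : 'rV[R]_d -> R, L2 (lebesgue_rV R d) Omega g &
    forall phi, test_function Omega phi ->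
      (\int[lebesgue_rV R d]_(x in Omega) (f x * pder i phi x) =
       - \int[lebesgue_rV R d]_(x in Omega) (g x * phi x))%R.

(* L^2(0,T; L^2(Omega)), identified with classes of jointly measurable
   functions *)
Definition L2t_L2 (d : nat) (T : R) (Omega : set 'rV[R]_d)
  (F : 'rV[R]_d -> R -> R) :=
  measurable_fun (Omega `*` `]0, T[) (fun z : 'rV[R]_d * R => F z.1 z.2) /\
  (\int[lebesgue_measure]_(t in `]0%R, T[)
     \int[lebesgue_rV R d]_(x in Omega) ((F x t) ^+ 2)%:E < +oo)%E.

End lebesgue_sobolev.

Section fractional.
Context (R : realType).
Local Notation mu := (@lebesgue_measure R).

Definition gamma_fun (b : R) : R :=
  \int[mu]_(x in `]0, +oo[) (x `^ (b - 1) * expR (- x)).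

Definition frac_integral (b : R) (f : R -> R) (t : R) : R :=
  (gamma_fun b)^-1 * \int[mu]_(s in `]0, t[) ((t - s) `^ (b - 1) * f s).

(* squared Sobolev-Slobodeckij norm of H^a(0,T), 0 < a < 1 *)
Definition Hnorm2 (a T : R) (v : R -> R) : \bar R :=
  (\int[mu]_(t in `]0%R, T[) ((v t) ^+ 2)%:E +
   \int[mu]_(t in `]0%R, T[) \int[mu]_(s in `]0%R, T[)
     (`|v t - v s| ^+ 2 / `|t - s| `^ (1 + 2 * a))%:E)%E.

Definition Hfrac (a T : R) (v : R -> R) :=
  measurable_fun `]0, T[ v /\ (Hnorm2 a T v < +oo)%E.

(* C^1[0,T] functions vanishing at 0 *)
Definition C1_vanishing0 (T : R) (v : R -> R) :=
  [/\ {within `[0, T], continuous v},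
      forall t, t \in `]0, T[ -> derivable v t 1,
      exists2 v' : R -> R, {within `[0, T], continuous v'} &
        forall t, t \in `]0, T[ -> v' t = derive1 v t &
      v 0 = 0].

(* H_a(0,T); for a = 1/2 the closure of C1_vanishing0 is the whole of
   H^{1/2}(0,T), so that case is defined separately. *)
Definition Halpha (a T : R) (v : R -> R) :=
  [/\ Hfrac a T v,
      a = 2^-1 ->
        (\int[mu]_(t in `]0%R, T[) (`|v t| ^+ 2 / t)%:E < +oo)%E &
      a <> 2^-1 -> forall e : R, 0 < e ->
        exists2 w : R -> R, C1_vanishing0 T w &
          (Hnorm2 a T (fun t => v t - w t)%R < (e ^+ 2)%:E)%E].

(* The graph of the fractional derivative of order a, that is, of the inverse
   of frac_integral a : L^2(0,T) -> L^2(0,T) on the domain H_a(0,T): w is the (a.e. unique)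
   derivative of f. *)
Definition is_frac_derive (a T : R) (f w : R -> R) :=
  [/\ Halpha a T f, L2 mu `]0, T[ w &
      {ae mu, forall t, t \in `]0, T[ -> frac_integral a w t = f t}].

End fractional.

Section elliptic_operator.
Context (R : realType) (d : nat).

Definition uniformly_elliptic (Omega : set 'rV[R]_d)
  (a : 'I_d -> 'I_d -> 'rV[R]_d -> R) :=
  exists2 kappa : R, 0 < kappa &
    forall x, Omega x -> forall xi : 'I_d -> R,
      kappa * \sum_j xi j ^+ 2 <= \sum_i \sum_j a i j x * xi i * xi j.

Definition A1 (a : 'I_d -> 'I_d -> 'rV[R]_d -> R)
  (b : 'I_d -> 'rV[R]_d -> R -> R) (b0 : 'rV[R]_d -> R -> R)
  (v : 'rV[R]_d -> R -> R) (x : 'rV[R]_d) (t : R) : R :=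
  - (\sum_i \sum_j pder i (fun y => a i j y * pder j (v^~ t) y) x
     + \sum_j b j x t * pder j (v^~ t) x
     - b0 x t * v x t).

Definition conormal_derive (Omega : set 'rV[R]_d)
  (nu : 'rV[R]_d -> 'rV[R]_d) (a : 'I_d -> 'I_d -> 'rV[R]_d -> R)
  (w : 'rV[R]_d -> R) (x : 'rV[R]_d) : R :=
  \sum_i \sum_j a i j x * pder_closure Omega j w x * nu x ord0 i.

End elliptic_operator.

(* Main.v *)
(* The barrier is purely local, so no auxiliary elliptic problem is solved and
   [M0 = 1] is enough.

   Let [u] attain a negative minimum over [closure Omega * [0, t1]], [t1 < T], at
   [(x0, t0)].  For almost every [x], [u - a] is the Abel integral of some [w] with
   [w + A1 u = F >= 0].  Convolving once more with a power kernel (Fubini and the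
   Beta integral) gives, with [p = 1 - alpha],
     int_0^tau (tau - t)^(p - 1) (u - a)(t) dt = c * int_0^tau w,  c >= 0.
   Letting [tau] tend to 0 shows [u(., 0) >= 0], hence [t0 > 0].  Subtracting the
   identity at [t0 - eta] from the one at [t0], and using that the kernel decreases,
   [w] cannot be nonnegative just before [t0]; since points [x] where the equation
   holds are dense, [A1 u (x0, t0) < 0] is impossible.

   If [x0] is interior, the gradient vanishes, the Hessian is nonnegative, and
   [A1 u <= b0 u < 0]: contradiction.  If [x0] lies on the boundary, take a defining
   function [phi] of [Omega] at [x0] and minimize
   [u + eps * (phi + K |x - x0|^2)] over a small cube: for [K] large and [eps] small
   the minimum is interior, which is excluded as before, or at [x0], where the
   conormal derivative would be positive although [x0] is a minimum. *)
Require Import Defs.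
From HB Require Import structures.
From mathcomp Require Import all_boot all_order all_algebra.
From mathcomp Require Import all_classical all_reals all_analysis.
From mathcomp Require Import measurable_realfun ring lra.

Set Implicit Arguments.
Unset Strict Implicit.
Unset Printing Implicit Defensive.

Import Order.TTheory GRing.Theory Num.Theory.
Import numFieldNormedType.Exports.

Local Open Scope classical_set_scope.
Local Open Scope ring_scope.

(** * Calculus on row vectors *)

(** The obstacle is regularity: for almost every x the fractional derivative is only an L^2 class in
    t, so it has no value at a minimum time, and the equation may fail at the minimum point itself.
    Hence [w] is only ever integrated, over (t0 - eta, t0), and at points x close to x0. A strict
    sign of [A1 u] survives the displacement by continuity. Differentiability in time at the single
    point (x0, t0), with a gradient bound in x, limits the growth of u above its minimum to order
    eta on the last interval. With kappa = - u(x0, t0) / 2, the decrease of the kernel yields kappa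
    * t0^(-alpha) * eta, while the error is of order eta * eta^(1 - alpha); so eta is fixed first,
    and x afterwards. Stopping at t1 < T ensures that a positive minimum time is one where u is
    differentiable in t. The bound b0 >= 1 serves the perturbed problem: where u < 0 it gives b0 u
    <= u, so eps can be computed from the minimum value and from bounds on the perturbation before
    the new minimum is located. *)

Section rV_calculus.
Context (R : realType) (d : nat).
Implicit Types (f g : 'rV[R]_d -> R) (x y z v p q : 'rV[R]_d).

Lemma is_derive_line f p v (s : R) : derivable f (p + s *: v) v ->
  is_derive s 1 (fun s => f (p + s *: v)) ('D_v f (p + s *: v)).
Proof.
have E : (fun h : R => h^-1 *: (f (p + (h *: (1 : R) + s) *: v) - f (p + s *: v)))
       = (fun h : R => h^-1 *: (f (h *: v + (p + s *: v)) - f (p + s *: v))).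
  by apply/funext => h; rewrite [h *: 1]mulr1 scalerDl addrCA.
move=> df; split; first by rewrite /derivable /= E.
by rewrite /derive /= E.
Qed.

Lemma rV_ballP x (r : R) y : ball x r y <-> 0 < r /\ forall i, `|x ord0 i - y ord0 i| < r.
Proof.
split.
  move=> b; split; last by move=> i; exact: b.2.
  by case: b.
by move=> [r0 H]; split => // i j; rewrite ord1; apply: H.
Qed.


Lemma mean_value_basis f p (i : 'I_d) (h c e : R) :
  (forall s : R, 0 <= s <= h -> derivable f (p + s *: basis_vec R i) (basis_vec R i) /\
     `|pder i f (p + s *: basis_vec R i) - c| <= e) -> 0 <= h ->
  `|f (p + h *: basis_vec R i) - f p - c * h| <= e * h.
Proof.
move=> H h0; set v := basis_vec R i in H *.
have D (s : R) : 0 <= s <= h ->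
    is_derive s 1 (fun s => f (p + s *: v)) ('D_v f (p + s *: v)).
  by move=> /H[? _]; exact: is_derive_line.
have [||s sh] := @MVT_segment R (fun s => f (p + s *: v)) (fun s => 'D_v f (p + s *: v)) 0 h h0.
- by move=> s; rewrite in_itv /= => /andP[s0 sh]; apply: D; rewrite !ltW.
- apply: derivable_within_continuous => s; rewrite in_itv /= => sh.
  by have [] := D s sh.
rewrite scale0r addr0 subr0 => ->; rewrite -mulrBl normrM (ger0_norm h0).
rewrite in_itv /= in sh.
by apply: ler_wpM2r => //; have [] := H s sh.
Qed.

(** The coordinates are changed one at a time, with the mean value theorem on each segment. With [c]
    the gradient at x this gives differentiability from partial derivatives; with [c] zero it gives
    a Lipschitz bound. *)
Lemma C1_increment f x (r : R) (c : 'I_d -> R) (e : R) :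
  (forall i y, ball x r y -> derivable f y (basis_vec R i) /\
     `|pder i f y - c i| <= e) ->
  forall y z, ball x r y -> ball x r z ->
  `|f z - f y - \sum_i c i * (z ord0 i - y ord0 i)|
    <= e * \sum_i `|z ord0 i - y ord0 i|.
Proof.
move=> H y z /rV_ballP[r0 xy] /rV_ballP[_ xz].
have step (p : 'rV[R]_d) i (h : R) : ball x r p -> ball x r (p + h *: basis_vec R i) ->
    `|f (p + h *: basis_vec R i) - f p - c i * h| <= e * `|h|.
  wlog h0 : p h / 0 <= h.
    move=> W bp bq; have [h0|h0] := leP 0 h; first exact: W.
    have := W (p + h *: basis_vec R i) (- h).
    rewrite oppr_ge0 (ltW h0) -addrA -scalerDl subrr scale0r addr0 normrN.
    move=> /(_ isT bq bp); rewrite -[X in X <= _]normrN.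
    by congr (`|_| <= _); rewrite mulrN opprK; ring.
  move=> /rV_ballP[_ bp] /rV_ballP[_ bq]; rewrite (ger0_norm h0).
  apply: mean_value_basis => // s /andP[s0 sh]; apply: H; apply/rV_ballP; split => // j.
  have := bp j; have := bq j; rewrite !mxE /=; case: eqP => _ /=; last by rewrite !mulr0.
  rewrite !mulr1 !ltr_norml; lra.
(* The path from y to z: its vertices stay in the ball because a ball of the sup norm is a cube. *)
pose w k : 'rV[R]_d := \row_i (if (i < k)%N then z ord0 i else y ord0 i).
have bw k : ball x r (w k).
  by apply/rV_ballP; split => // i; rewrite mxE; case: ifP.
have w0 : w 0%N = y by apply/rowP => i; rewrite mxE.
have wd : w d = z by apply/rowP => i; rewrite mxE ltn_ord.
have wE (i : 'I_d) : w i.+1 = w i + (z ord0 i - y ord0 i) *: basis_vec R i.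
  apply/rowP => j; rewrite !mxE /= ltnS; have [ji|ij|/val_inj ->] := ltngtP j i.
  - by rewrite (_ : j == i = false) ?mulr0 ?addr0 //; apply: contraTF ji => /eqP ->; rewrite ltnn.
  - by rewrite (_ : j == i = false) ?mulr0 ?addr0 //; apply: contraTF ij => /eqP ->; rewrite ltnn.
  - by rewrite eqxx mulr1 addrCA subrr addr0.
have -> : f z - f y = \sum_(i < d) (f (w i.+1) - f (w i)).
  by rewrite -(big_mkord xpredT (fun k => f (w k.+1) - f (w k))) telescope_sumr // wd w0.
rewrite -sumrB mulr_sumr; apply: le_trans (ler_norm_sum _ _ _) _; apply: ler_sum => i _.
by have := step (w i) i (z ord0 i - y ord0 i); rewrite -wE; apply.
Qed.

(** Stated through partial derivatives alone, because these are what [smooth_on] and [Ck_closure]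
    control; derivatives in other directions are recovered from [C1_increment]. *)
Definition C1_at f x := (\forall y \near x, forall i, derivable f y (basis_vec R i)) /\
  forall i, {for x, continuous (pder i f)}.

Lemma C1_at_increment f x (e : R) : C1_at f x -> 0 < e ->
  exists2 r : R, 0 < r & forall y z, ball x r y -> ball x r z ->
  `|f z - f y - \sum_i pder i f x * (z ord0 i - y ord0 i)|
    <= e * \sum_i `|z ord0 i - y ord0 i|.
Proof.
move=> [df cf] e0.
have : \forall y \near x, forall i : 'I_d, derivable f y (basis_vec R i) /\
     `|pder i f y - pder i f x| <= e.
  have H : \forall y \near x, forall i : 'I_d, `|pder i f y - pder i f x| <= e.
    apply: (@filter_forall _ _ (fun i y => `|pder i f y - pder i f x| <= e) (nbhs x)) => i.
    have /cvgr_dist_le := cf i.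
    by move/(_ e e0); apply: filterS => y; rewrite distrC.
  by apply: filterS2 df H => y; split.
move=> /nbhs_ballP[r /= r0 H]; exists r => // y z.
by apply: C1_increment => i {}y /H.
Qed.

Lemma C1_at_is_derive f x v : C1_at f x ->
  is_derive x v f (\sum_i v ord0 i * pder i f x).
Proof.
move=> fx; set l := \sum_i _.
suff H : h^-1 *: (f (h *: v + x) - f x) @[h --> (0 : R)^'] --> l.
  split; first by apply/cvg_ex; exists l.
  exact/cvg_lim.
set N := \sum_i `|v ord0 i|; have N0 : 0 <= N by apply: sumr_ge0.
apply/cvgrPdist_le => /= e e0.
have e'0 : 0 < e / (N + 1) by rewrite divr_gt0 // ltr_wpDl.
have [r r0 H] := C1_at_increment fx e'0.
have bh : \forall h \near (0 : R)^', ball x r (h *: v + x).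
  apply: nbhs_dnbhs.
  have : h *: v + x @[h --> (0 : R)] --> 0 *: v + x.
    by apply: cvgD; [apply: cvgZr_tmp|apply: cvg_cst].
  by rewrite scale0r add0r => /cvg_ballP; apply.
near=> h.
have h0 : h != 0 by near: h; exact: nbhs_dnbhs_neq.
have bxh : ball x r (h *: v + x) by near: h.
have := H x (h *: v + x) (ballxx _ r0) bxh.
have E i : (h *: v + x) ord0 i - x ord0 i = h * v ord0 i by rewrite !mxE addrK.
under eq_bigr do rewrite E mulrCA [pder _ _ _ * _]mulrC.
under [in X in _ <= X]eq_bigr do rewrite E normrM.
rewrite -!mulr_sumr -/l -/N => {}H.
have hp : 0 < `|h| by rewrite normr_gt0.
rewrite -(ler_pM2l hp) -normrM [h^-1 *: _]mulrC mulrBr mulrCA divff // mulr1 distrC.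
apply: le_trans H _; rewrite mulrCA ler_wpM2l // -[leRHS]mulr1.
rewrite -mulrA ler_wpM2l ?(ltW e0) // mulrC ler_pdivrMr ?ltr_wpDl // mul1r; lra.
Unshelve. all: by end_near. Qed.

Lemma C1_at_is_derive_line f p v (s : R) : C1_at f (p + s *: v) ->
  is_derive s 1 (fun s => f (p + s *: v)) (\sum_i v ord0 i * pder i f (p + s *: v)).
Proof.
move=> /(@C1_at_is_derive _ _ v)[df <-]; exact: is_derive_line.
Qed.

Lemma C1_at_continuous f x : C1_at f x -> {for x, continuous f}.
Proof.
move=> fx; have [r r0 H] := C1_at_increment fx ltr01.
set N := \sum_i (`|pder i f x| + 1).
have N0 : 0 <= N by apply: sumr_ge0 => i _; rewrite addr_ge0.
have : f y @[y --> x] --> f x; last by apply.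
apply: (proj2 (@cvgrPdist_le _ _ _ (nbhs x) _ f (f x))) => e e0.
have e'0 : 0 < e / (N + 1) by rewrite divr_gt0 // ltr_wpDl.
near=> y.
have xy : ball x r y by near: y; exact: nbhsx_ballx.
have : ball x (e / (N + 1)) y by near: y; exact: nbhsx_ballx.
move=> /rV_ballP[_ xye].
have -> : f x - f y = - ((f y - f x - \sum_i pder i f x * (y ord0 i - x ord0 i))
   + \sum_i pder i f x * (y ord0 i - x ord0 i)) by rewrite subrK opprB.
rewrite normrN; apply: le_trans (ler_normD _ _) _.
have Hy := H x y (ballxx _ r0) xy.
apply: le_trans (lerD Hy (ler_norm_sum _ _ _)) _.
rewrite mul1r -big_split /=; apply: (@le_trans _ _ (N * (e / (N + 1)))).
  rewrite mulr_suml; apply: ler_sum => i _.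
  rewrite normrM -{1}[`|_ - _|]mul1r -mulrDl addrC.
  by apply: ler_wpM2l; rewrite ?addr_ge0 // distrC ltW.
rewrite mulrCA -[leRHS]mulr1 ler_wpM2l ?(ltW e0) // ler_pdivrMr ?ltr_wpDl // mul1r; lra.
Unshelve. all: by end_near. Qed.

Definition C2_at f x := (\forall y \near x, C1_at f y) /\ forall i, C1_at (pder i f) x.

Lemma near_line (P : set 'rV[R]_d) x v : (\forall y \near x, P y) ->
  exists2 e : R, 0 < e & forall s : R, `|s| < e -> P (x + s *: v).
Proof.
move=> Px.
have : x + s *: v @[s --> (0 : R)] --> x + 0 *: v.
  by apply: cvgD; [apply: cvg_cst|apply: cvgZr_tmp].
rewrite scale0r addr0 => /(_ _ Px) /= /nbhs_ballP[e /= e0 H]; exists e => // s se.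
by apply: H => /=; rewrite /ball /= sub0r normrN.
Qed.

Lemma is_derive_lt_right (k : R -> R) (s l : R) : is_derive s 1 k l -> l < 0 ->
  exists2 e : R, 0 < e & forall h, 0 < h < e -> k (s + h) < k s.
Proof.
move=> [dk <-] l0.
have /cvgr_lt /(_ _ l0) : h^-1 *: (k (h *: 1 + s) - k s) @[h --> (0 : R)^'] --> 'D_1 k s.
  exact: dk.
move=> /nbhs_ballP[e /= e0 H]; exists e => // h /andP[h0 he].
have := H h; rewrite /ball /= sub0r normrN gtr0_norm // => /(_ he).
rewrite (gt_eqF h0) [h *: 1]mulr1 [h + s]addrC => /(_ isT).
by rewrite [_ *: _]/(_ * _) pmulr_rlt0 ?invr_gt0 // subr_lt0.
Qed.

Lemma local_min_grad f x : C2_at f x -> (\forall y \near x, f x <= f y) ->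
  forall i, pder i f x = 0.
Proof.
move=> [fx _] minx i.
have [e e0 H] := near_line (basis_vec R i) (filterI fx minx).
have D (s : R) : `|s| < e -> is_derive s 1 (fun s => f (x + s *: basis_vec R i))
    (pder i f (x + s *: basis_vec R i)).
  move=> /H[[df _] _]; apply: is_derive_line; exact: (nbhs_singleton df).
have inI (t : R) : t \in `]- e, e[ -> `|t| < e by rewrite in_itv ltr_norml.
have I0 : (0 : R) \in `]- e, e[ by rewrite in_itv /= oppr_lt0 e0.
have : is_derive (0 : R) 1 (fun s => f (x + s *: basis_vec R i)) 0.
  apply: derive1_at_min I0 _; first by rewrite ge0_cp // ltW.
    by move=> t /inI /D[].
  by move=> t /inI /H[_]; rewrite scale0r addr0.
move=> [_]; have [|_ ->] := D 0; first by rewrite normr0.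
by rewrite scale0r addr0.
Qed.

(** Along the line through x in direction q, the slope [k] vanishes at 0. Were its derivative
    negative, [k] would be negative just to the right of 0, and the mean value theorem would push f
    below its minimum. *)
Lemma local_min_hessian f x : C2_at f x -> (\forall y \near x, f x <= f y) ->
  forall q, 0 <= \sum_i \sum_j q ord0 i * q ord0 j * pder i (pder j f) x.
Proof.
move=> fC2 minx q; have g0 := local_min_grad fC2 minx; move: fC2 => [fx dfx].
have [e e0 H] := near_line q (filterI fx minx).
pose k (s : R) := \sum_j q ord0 j * pder j f (x + s *: q).
have Dg (s : R) : `|s| < e -> is_derive s 1 (fun s => f (x + s *: q)) (k s).
  by move=> /H[? _]; exact: C1_at_is_derive_line.
have Dk : is_derive (0 : R) 1 k (\sum_i \sum_j q ord0 i * q ord0 j * pder i (pder j f) x).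
  have -> : k = \sum_j (q ord0 j \*: (fun s => pder j f (x + s *: q))).
    by apply/funext => s; rewrite /k fct_sumE.
  rewrite exchange_big /=.
  have dj j : is_derive (0 : R) 1 (fun s => pder j f (x + s *: q))
     (\sum_i q ord0 i * pder i (pder j f) x).
    have := @C1_at_is_derive_line (pder j f) x q 0.
    by rewrite scale0r addr0; exact.
  apply: is_derive_eq; apply: eq_bigr => j _.
  rewrite scaler_sumr; apply: eq_bigr => i _.
  by rewrite /GRing.scale /= mulrCA mulrA.
set l := \sum_i _ in Dk *; rewrite leNgt; apply/negP => l0.
have k0 : k 0 = 0.
  by rewrite /k big1 // => j _; rewrite scale0r addr0 g0 mulr0.
have [e1 e10 He1] := is_derive_lt_right Dk l0.
pose s := Num.min e e1 / 2.
have s0 : 0 < s by rewrite divr_gt0 // lt_min e0.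
have [se se1] : s < e /\ s < e1.
  have : s < Num.min e e1 by rewrite /s ltr_pdivrMr // mulr2n mulrDr mulr1 ltrDl lt_min e0.
  by rewrite lt_min => /andP.
have [||c cs] := @MVT R (fun s => f (x + s *: q)) k 0 s s0.
- move=> t; rewrite in_itv /= => /andP[t0 ts]; apply: Dg.
  by rewrite gtr0_norm // (lt_trans ts).
- apply: derivable_within_continuous => t; rewrite in_itv /= => /andP[t0 ts].
  by have [] := Dg t; first by rewrite ger0_norm // (le_lt_trans ts).
rewrite in_itv /= in cs; have /andP[c0 c1] := cs.
rewrite scale0r addr0 subr0.
have := He1 c; rewrite add0r k0 c0 (lt_trans c1 se1) => /(_ isT) kc.
have [|_] := H s; first by rewrite gtr0_norm.
by move=> + E; rewrite -subr_ge0 E leNgt pmulr_llt0 // kc.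
Qed.

End rV_calculus.

(* Eliminating the first variable writes [A] as a positive rank one form plus a
   positive definite form in the remaining variables. *)
Lemma posdef_trace_ge0 (R : realFieldType) n (A H : 'I_n -> 'I_n -> R) :
  (forall i j, A i j = A j i) ->
  (forall xi : 'I_n -> R, (exists i, xi i != 0) ->
     0 < \sum_i \sum_j A i j * xi i * xi j) ->
  (forall q : 'I_n -> R, 0 <= \sum_i \sum_j q i * q j * H i j) ->
  0 <= \sum_i \sum_j A i j * H i j.
Proof.
elim: n A H => [|n IH] A H symA posA posH; first by rewrite big_ord0.
have a0 : 0 < A ord0 ord0.
  have /posA : exists i : 'I_n.+1, (i == ord0)%:R != 0 :> R.
    by exists ord0; rewrite eqxx oner_eq0.
  rewrite (bigD1 ord0) //= (bigD1 ord0) //= !mulr1.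
  rewrite big1 ?addr0; last by move=> i /negbTE ->; rewrite mulr0.
  rewrite big1 ?addr0 // => i /negbTE ->; apply: big1 => j _; by rewrite mulr0 mul0r.
set a := A ord0 ord0 in a0; pose q i := A i ord0 / a.
pose B i j := A i j - a * q i * q j.
have q0 : q ord0 = 1 by rewrite /q divff // gt_eqF.
have B0 j : B ord0 j = 0.
  by rewrite /B q0 mulr1 /q mulrC divfK ?gt_eqF // symA subrr.
have B0' j : B j ord0 = 0.
  by rewrite /B q0 mulr1 /q mulrC divfK ?gt_eqF // subrr.
have split (F : 'I_n.+1 -> 'I_n.+1 -> R) : \sum_i \sum_j A i j * F i j =
    a * \sum_i \sum_j q i * q j * F i j +
    \sum_i \sum_j B (lift ord0 i) (lift ord0 j) * F (lift ord0 i) (lift ord0 j).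
  have -> : \sum_i \sum_j B (lift ord0 i) (lift ord0 j) * F (lift ord0 i) (lift ord0 j) =
      \sum_i \sum_j B i j * F i j.
    rewrite big_ord_recl [X in X + _]big1 ?add0r; last by move=> j _; rewrite B0 mul0r.
    by apply: eq_bigr => i _; rewrite big_ord_recl B0' mul0r add0r.
  rewrite mulr_sumr -big_split; apply: eq_bigr => i _ /=.
  rewrite mulr_sumr -big_split; apply: eq_bigr => j _ /=; rewrite /B; ring.
rewrite split addr_ge0 //; first by rewrite mulr_ge0 ?posH // ltW.
apply: (IH (fun i j => B (lift ord0 i) (lift ord0 j))).
- by move=> i j; rewrite /B symA [a * _ * _]mulrAC.
- move=> xi [i0 xi0].
  (* The first entry makes the sum of q i * xi' i vanish, so the rank one part contributes nothing
     and positivity of A on xi' is positivity of the remaining form on xi. *)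
  pose xi' (i : 'I_n.+1) : R := if unlift ord0 i is Some j then xi j
                          else - \sum_j q (lift ord0 j) * xi j.
  have /posA : exists i, xi' i != 0 by exists (lift ord0 i0); rewrite /xi' liftK.
  under eq_bigr do under eq_bigr do rewrite -mulrA.
  rewrite (split (fun i j => xi' i * xi' j)).
  have -> : \sum_i \sum_j q i * q j * (xi' i * xi' j) = (\sum_i q i * xi' i) ^+ 2.
    rewrite expr2 mulr_suml; apply: eq_bigr => i _; rewrite mulr_sumr.
    by apply: eq_bigr => j _; ring.
  have -> : \sum_i q i * xi' i = 0.
    rewrite big_ord_recl q0 mul1r {1}/xi' unlift_none.
    rewrite addrC; apply/eqP; rewrite subr_eq0; apply/eqP.
    by apply: eq_bigr => j _; rewrite /xi' liftK.
  rewrite expr0n mulr0 add0r; congr (_ < _).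
  by apply: eq_bigr => i _; apply: eq_bigr => j _; rewrite /xi' !liftK mulrA.
- move=> p; have := posH (fun i => if unlift ord0 i is Some j then p j else 0).
  rewrite big_ord_recl [X in X + _]big1 ?add0r; last first.
    by move=> j _; rewrite unlift_none !mul0r.
  congr (_ <= _); apply: eq_bigr => i _; rewrite big_ord_recl unlift_none mulr0 mul0r add0r.
  by apply: eq_bigr => j _; rewrite !liftK.
Qed.

(** * Linear combinations of C^1 and C^2 functions; the squared distance *)

Lemma cvg_axpy (R : realType) (S : Type) (F : set_system S) {FF : Filter F}
  (f g : S -> R) (c a b : R) :
  f @ F --> a -> g @ F --> b -> (fun y => f y + c * g y) @ F --> a + c * b.
Proof. by move=> fa gb; apply: cvgD => //; apply: cvgMl_tmp. Qed.

Section C2_algebra.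
Context (R : realType) (d : nat).
Implicit Types (f g : 'rV[R]_d -> R) (x y : 'rV[R]_d).

(** The combination f + c * g covers both uses: c = -1 for differences of time slices, c = eps for
    the perturbed minimum problem. *)
Lemma pder_axpy f g (c : R) i x :
  derivable f x (basis_vec R i) -> derivable g x (basis_vec R i) ->
  derivable (fun y => f y + c * g y) x (basis_vec R i) /\
  pder i (fun y => f y + c * g y) x = pder i f x + c * pder i g x.
Proof.
move=> df dg.
have D : is_derive x (basis_vec R i) (f + (c \*: g)) (pder i f x + c *: pder i g x).
  by apply: is_deriveD; [exact: derivableP|apply: is_deriveZ; exact: derivableP].
by case: D => D1 D2; split.
Qed.

Lemma near_eq_continuous_at f g x : (\forall y \near x, f y = g y) ->
  {for x, continuous f} -> {for x, continuous g}.
Proof.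
move=> fg fx; have fgx := nbhs_singleton fg.
have : g y @[y --> x] --> f x.
  by apply: cvg_trans fx; apply: (near_eq_cvg fg).
by rewrite fgx; apply.
Qed.

Lemma C1_at_near_eq f g x : (\forall y \near x, f y = g y) -> C1_at f x -> C1_at g x.
Proof.
move=> fg [df cf]; have fg' := near_join fg; split.
  apply: filterS2 df fg' => y dfy fgy i.
  exact: near_eq_derivable fgy (dfy i).
move=> i; apply: near_eq_continuous_at (cf i).
by apply: filterS fg' => y fgy; apply: near_eq_derive.
Qed.

Lemma C1_at_axpy f g (c : R) x : C1_at f x -> C1_at g x ->
  C1_at (fun y => f y + c * g y) x.
Proof.
move=> [df cf] [dg cg]; split.
  by apply: filterS2 df dg => y dfy dgy i; have [] := pder_axpy c (dfy i) (dgy i).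
move=> i; apply: (@near_eq_continuous_at (fun y => pder i f y + c * pder i g y)).
  by apply: filterS2 df dg => y dfy dgy; have [_ ->] := pder_axpy c (dfy i) (dgy i).
exact: (@cvg_axpy _ _ (nbhs x) _ (pder i f) (pder i g) c _ _ (cf i) (cg i)).
Qed.

Lemma C1_at_pder_axpy f g (c : R) i x : C1_at f x -> C1_at g x ->
  pder i (fun y => f y + c * g y) x = pder i f x + c * pder i g x.
Proof.
move=> [/nbhs_singleton df _] [/nbhs_singleton dg _].
by have [] := pder_axpy c (df i) (dg i).
Qed.

Lemma C2_at_axpy f g (c : R) x : C2_at f x -> C2_at g x ->
  C2_at (fun y => f y + c * g y) x /\ forall i j,
  pder i (pder j (fun y => f y + c * g y)) x =
  pder i (pder j f) x + c * pder i (pder j g) x.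
Proof.
move=> [f1 f2] [g1 g2].
have E i : \forall y \near x, pder i f y + c * pder i g y = pder i (fun y => f y + c * g y) y.
  by apply: filterS2 f1 g1 => y fy gy; rewrite C1_at_pder_axpy.
split; first split.
- by apply: filterS2 f1 g1 => y; exact: C1_at_axpy.
- by move=> i; apply: C1_at_near_eq (E i) _; exact: C1_at_axpy.
move=> i j; rewrite -C1_at_pder_axpy //; apply/esym/near_eq_derive; exact: E.
Qed.

Lemma C2_at_C1 f x : C2_at f x -> C1_at f x.
Proof. by move=> [/nbhs_singleton]. Qed.

Lemma smooth_on_C2 (U : set 'rV[R]_d) f x : open U -> smooth_on U f -> U x -> C2_at f x.
Proof.
move=> oU sf Ux; have nU : \forall y \near x, U y by exact: open_nbhs_nbhs.
have C1 s y : U y -> C1_at (pders s f) y.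
  move=> Uy; have nUy : \forall z \near y, U z by exact: open_nbhs_nbhs.
  split; first by apply: filterS nUy => z Uz i; have [_] := sf s z Uz; exact.
  by move=> i; have [] := sf (i :: s) y Uy.
split; first by apply: filterS nU => y; exact: (C1 [::]).
by move=> i; exact: (C1 [:: i]).
Qed.

Definition sqdist (x y : 'rV[R]_d) : R := \sum_i (y ord0 i - x ord0 i) ^+ 2.

Lemma is_derive_coord (c : R) j i y :
  is_derive y (basis_vec R i) (fun y : 'rV[R]_d => y ord0 j - c) ((i == j)%:R : R).
Proof.
  have L : h^-1 *: (((h *: basis_vec R i + y) ord0 j - c) - (y ord0 j - c))
      @[h --> (0 : R)^'] --> ((i == j)%:R : R).
    apply: (@cvg_trans _ (cst ((i == j)%:R : R) @ (0 : R)^')); last exact: cvg_cst.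
    apply: near_eq_cvg; near=> h.
    have h0 : h != 0 by near: h; exact: nbhs_dnbhs_neq.
    rewrite /cst !mxE /= [j == i]eq_sym [_ *: _]/(_ * _).
    set q := y ord0 j; set r := c; set b := (i == j)%:R.
    have -> : h * b + q - r - (q - r) = h * b by ring.
    by rewrite -[RHS]/(h^-1 * (h * b)) mulKf.
  split; first by apply/cvg_ex; exists ((i == j)%:R).
  exact/cvg_lim.
Unshelve. all: by end_near. Qed.

Lemma pder_sqdist x i y : derivable (sqdist x) y (basis_vec R i) /\
  pder i (sqdist x) y = 2 * (y ord0 i - x ord0 i).
Proof.
have D j : is_derive y (basis_vec R i) (fun y : 'rV[R]_d => (y ord0 j - x ord0 j) ^+ 2)
   (2 * (y ord0 i - x ord0 i) * (i == j)%:R).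
  have H := is_derive_coord (x ord0 j) j i y.
  have -> : (fun y : 'rV[R]_d => (y ord0 j - x ord0 j) ^+ 2) =
      (fun y : 'rV[R]_d => y ord0 j - x ord0 j) ^+ 2 by apply/funext => z; rewrite fctE.
  apply: (@is_derive_eq _ _ _ _ _ _ _ _ (@is_deriveX _ _ _ 2 _ _ _ H)).
  have [->|ij] := eqVneq i j; last by rewrite scaler0 mulr0.
  by rewrite [LHS]mulr1 mulr1.
have -> : sqdist x = \sum_j (fun y : 'rV[R]_d => (y ord0 j - x ord0 j) ^+ 2).
  by apply/funext => z; rewrite /sqdist fct_sumE.
have [D1 D2] := @is_derive_sum _ _ _ d _ y (basis_vec R i) _ D.
split => //; rewrite /pder D2 (bigD1 i) //= eqxx mulr1 big1 ?addr0 //.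
by move=> j /negbTE ji; rewrite eq_sym ji mulr0.
Unshelve. all: by end_near. Qed.

Lemma C2_at_sqdist x y : C2_at (sqdist x) y.
Proof.
have E i : pder i (sqdist x) = (fun y : 'rV[R]_d => 2 * (y ord0 i - x ord0 i)).
  by apply/funext => z; have [_] := pder_sqdist x i z.
have D i j z : is_derive z (basis_vec R j) (pder i (sqdist x)) (2 * (j == i)%:R).
  by rewrite E; apply: (is_deriveZ _ (is_derive_coord (x ord0 i) i j z)).
have C1 i z : C1_at (pder i (sqdist x)) z.
  split; first by apply: (@filterE _ (nbhs z) _) => t j; have [] := D i j t.
  move=> j; have -> : pder j (pder i (sqdist x)) = cst (2 * (j == i)%:R).
    by apply/funext => t; have [_] := D i j t.
  exact: (@cvg_cst _ _ _ (nbhs z) _).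
split; last by move=> i; exact: C1.
apply: (@filterE _ (nbhs y) _) => z; split; first by apply: (@filterE _ (nbhs z) _) => t j; have [] := pder_sqdist x j t.
by move=> i; exact: C1_at_continuous.
Qed.

End C2_algebra.

(** * Null sets for Lebesgue measure on R^n *)

Section lebesgue_rV_theory.
Context (R : realType).

Definition rV_box n (a b : 'rV[R]_n) : set 'rV[R]_n :=
  [set x | forall i, a ord0 i < x ord0 i < b ord0 i].

Lemma measurable_rV_box n (a b : 'rV[R]_n) : measurable (rV_box a b).
Proof.
have -> : rV_box a b = \bigcap_(i : 'I_n)
    ((fun x : 'rV[R]_n => x ord0 i) @^-1` `]a ord0 i, b ord0 i[).
  apply/seteqP; split=> x /= H i; first by move=> _; rewrite /= in_itv /= H.
  by have := H i Logic.I; rewrite /= in_itv.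
apply: fin_bigcap_measurable => // i _.
by rewrite -[X in measurable X]setTI; apply: measurable_coord.
Qed.

Lemma rV_cons0 n (p : 'rV[R]_n * R) : rV_cons p ord0 ord0 = p.2.
Proof.
rewrite (_ : ord0 = lshift n ord0 :> 'I_(1 + n)); last exact/val_inj.
by rewrite [LHS](row_mxEl (p.2%:M : 'rV_1)) mxE eqxx mulr1n.
Qed.

Lemma rV_consS n (p : 'rV[R]_n * R) j : rV_cons p ord0 (lift ord0 j) = p.1 ord0 j.
Proof.
rewrite (_ : lift ord0 j = rshift 1 j :> 'I_(1 + n)); last exact/val_inj.
exact: (row_mxEr (p.2%:M : 'rV_1)).
Qed.

Lemma lebesgue_rV_box_gt0 n (a b : 'rV[R]_n) : (forall i, a ord0 i < b ord0 i) ->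
  (0 < lebesgue_rV R n (rV_box a b))%E.
Proof.
elim: n a b => [|n IH] a b ab.
  rewrite /= diracE mem_set ?lte01 //=; by case.
rewrite lebesgue_rVS.
pose a' : 'rV[R]_n := \row_j a ord0 (lift ord0 j).
pose b' : 'rV[R]_n := \row_j b ord0 (lift ord0 j).
have -> : @rV_cons R n @^-1` rV_box a b = rV_box a' b' `*` `]a ord0 ord0, b ord0 ord0[.
  apply/seteqP; split=> [[p r] /= H|[p r] /= [H1]].
    split; last by rewrite /= in_itv /=; have := H ord0; rewrite rV_cons0.
    by move=> j /=; have := H (lift ord0 j); rewrite rV_consS !mxE.
  rewrite /= in_itv /= => H2 i.
  have [j ->|->] := unliftP ord0 i; last by rewrite rV_cons0.
  by rewrite rV_consS; have := H1 j; rewrite !mxE.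
rewrite product_measure1E //; last exact: measurable_rV_box.
rewrite mule_gt0 //; first by apply: IH => i; rewrite !mxE.
have : (0 < lebesgue_measure (`]a ord0 ord0, b ord0 ord0[%classic : set R))%E.
  by rewrite lebesgue_measure_itv /= lte_fin ab -EFinB lte_fin subr_gt0 ab.
exact.
Qed.

(** A null set contains no box, since boxes have positive measure. This supplies points where the
    equation holds arbitrarily close to a minimum point. *)
Lemma ae_lebesgue_rV_dense n (P : 'rV[R]_n -> Prop) (U : set ('rV[R]_n)) (x : 'rV[R]_n) :
  {ae lebesgue_rV R n, forall x, P x} -> nbhs x U ->
  exists2 y, U y & P y.
Proof.
move=> [N [mN N0 PN]] /nbhs_ballP[r /= r0 rU].
apply: contrapT => H.
pose a : 'rV[R]_n := \row_i (x ord0 i - r); pose b : 'rV[R]_n := \row_i (x ord0 i + r).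
have boxN : rV_box a b `<=` N.
  move=> y yab; apply: PN => /= Py; apply: H; exists y => //; apply: rU; split => // i j.
  rewrite ord1 /ball /= ltr_distlC; have := yab j; rewrite !mxE; lra.
have ab i : a ord0 i < b ord0 i by rewrite !mxE; lra.
have := lebesgue_rV_box_gt0 ab; rewrite ltNge => /negP; apply.
by rewrite -N0; apply: le_measure => //; rewrite inE //; exact: measurable_rV_box.
Qed.

End lebesgue_rV_theory.

(** The product measure of a set is the integral of the measures of its sections; if it is zero,
    almost every section is null. It turns the sign of F, known almost everywhere in space-time,
    into a statement for almost every x and then almost every t. *)
Lemma ae_product d1 d2 (T1 : measurableType d1) (T2 : measurableType d2) (R : realType)
  (m1 : {measure set T1 -> \bar R}) (m2 : {sigma_finite_measure set T2 -> \bar R})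
  (Q : T1 * T2 -> Prop) :
  {ae (m1 \x m2)%E, forall z, Q z} ->
  {ae m1, forall x, {ae m2, forall y, Q (x, y)}}.
Proof.
move=> [N [mN N0 QN]].
have : ae_eq m1 setT (fun x => m2 (xsection N x)) (cst 0%E).
  apply/ae_eq_integral_abs => //; first exact: measurable_fun_xsection.
  rewrite -[RHS]N0 /=; apply: eq_integral => x _.
  by rewrite gee0_abs.
apply: filterS => x /(_ Logic.I) /= Nx.
exists (xsection N x); split => //; first exact: measurable_xsection.
by move=> y Hy; rewrite /xsection /= inE; apply: QN.
Qed.

(** * Abel integrals *)

Section affine_change_of_variables.
Context (R : realType).
Local Notation mu := (@lebesgue_measure R).
Local Open Scope ereal_scope.

Lemma ge0_integral_oppr (f : R -> \bar R) :
  measurable_fun [set: R] f -> (forall x, 0 <= f x) ->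
  \int[mu]_x f (- x)%R = \int[mu]_x f x.
Proof.
move=> mf f0.
rewrite -[in LHS](@preimage_setT _ (measurableTypeR R) (-%R : R -> measurableTypeR R)).
rewrite -(@ge0_integral_pushforward _ _ (measurableTypeR R) (measurableTypeR R) _ _ _ mu setT f) //=.
by apply: eq_measure_integral => //= A mA AS; exact: lebesgue_measureN.
Qed.

(** The pushforward of Lebesgue measure under x -> a x + b, scaled by a, gives every half-open
    interval its length, so by uniqueness it is Lebesgue measure. *)
Lemma ge0_integral_affine (a b : R) (f : R -> \bar R) : (0 < a)%R ->
  measurable_fun [set: R] f -> (forall x, 0 <= f x) ->
  a%:E * \int[mu]_x f (a * x + b)%R = \int[mu]_x f x.
Proof.
move=> a0 mf f0; pose phi (x : R) : measurableTypeR R := (a * x + b)%R.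
have mphi : measurable_fun [set: R] phi by apply: measurable_funD.
rewrite -[in LHS](@preimage_setT _ (measurableTypeR R) phi).
rewrite -(@ge0_integral_pushforward _ _ (measurableTypeR R) (measurableTypeR R) _ _ mphi mu setT f) //=.
pose k := NngNum (ltW a0).
rewrite -[a]/(k%:num)%R -ge0_integral_mscale //.
apply: eq_measure_integral => //= A mA _; apply/esym/lebesgue_measure_unique => //= _ [[c e]] _ <-.
rewrite /mscale /=; transitivity (a%:E * mu (phi @^-1` `]c, e])); last by [].
have -> : phi @^-1` `]c, e] = `]((c - b) / a)%R, ((e - b) / a)%R]%classic.
  apply/seteqP; split => x; rewrite /phi /= !in_itv /= ltr_pdivrMr // ler_pdivlMr //;
    by rewrite ltrBlDr lerBrDr mulrC.
rewrite !lebesgue_measure_itv /= !lte_fin ltr_pM2r ?invr_gt0 // ltrD2r.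
case: ifPn => ce; last by rewrite mule0.
rewrite -!EFinB -EFinM; congr (_%:E); field; exact: lt0r_neq0.
Qed.

Lemma ge0_integral_subl (c : R) (f : R -> \bar R) :
  measurable_fun [set: R] f -> (forall x, 0 <= f x) ->
  \int[mu]_x f (c - x)%R = \int[mu]_x f x.
Proof.
move=> mf f0.
rewrite -[RHS](@ge0_integral_affine 1 c) // mul1e.
rewrite -[RHS]ge0_integral_oppr //.
  by apply: eq_integral => x _; rewrite mul1r addrC.
apply: (@measurableT_comp _ _ _ _ _ _ f) => //.
exact: measurable_funD.
Qed.

End affine_change_of_variables.

Section power_kernel.
Context (R : realType).
Local Notation mu := (@lebesgue_measure R).

(** Extended by zero to x <= 0, so that Abel integrals become convolutions on the whole line and a
    change of variables moves no endpoints. *)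
Definition power_kernel (p x : R) : R := if 0 < x then x `^ (p - 1) else 0.

Lemma power_kernel_ge0 p x : 0 <= power_kernel p x.
Proof. by rewrite /power_kernel; case: ifP => // _; exact: powR_ge0. Qed.

Lemma measurable_power_kernel p : measurable_fun [set: R] (power_kernel p).
Proof.
apply: measurable_fun_if => //.
- by apply: measurable_fun_ltr.
- by apply: measurable_funTS; exact: measurable_powR.
Qed.

Lemma power_kernelM p a x : 0 < a ->
  power_kernel p (a * x) = a `^ (p - 1) * power_kernel p x.
Proof.
move=> a0; rewrite /power_kernel pmulr_rgt0 //; case: ifPn => [x0|]; last by rewrite mulr0.
by rewrite powRM // ltW.
Qed.

Lemma continuous_powR_gt0 (p x : R) : 0 < x -> {for x, continuous (@powR R ^~ p)}.
Proof.
move=> x0; apply: differentiable_continuous; apply/derivable1_diffP.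
by apply: derivable_powR; rewrite in_itv /= andbT.
Qed.

Lemma integral_powR_itv (p a b : R) : 0 < p -> 0 < a -> a < b ->
  (\int[mu]_(x in `[a, b]) (x `^ (p - 1))%:E = ((b `^ p - a `^ p) / p)%:E)%E.
Proof.
move=> p0 a0 ab; have b0 := lt_trans a0 ab.
rewrite (@continuous_FTC2 _ _ (fun x => p^-1 * x `^ p)) //.
- by rewrite -EFinB; congr (_%:E); rewrite mulrBl; congr (_ - _); rewrite mulrC.
- move=> x; apply: (@continuous_in_subspaceT _ _ `[a, b]%classic) => {}x.
  rewrite inE /= in_itv /= => /andP[ax _]; apply: continuous_powR_gt0.
  exact: lt_le_trans ax.
- split.
  + move=> x; rewrite in_itv /= => /andP[ax _]; apply: derivableM => //.
    by apply: derivable_powR; rewrite in_itv /= andbT (lt_trans a0).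
  + apply: cvg_at_right_filter; apply: cvgMl_tmp; exact: continuous_powR_gt0.
  + apply: cvg_at_left_filter; apply: cvgMl_tmp; exact: continuous_powR_gt0.
- move=> x; rewrite in_itv /= => /andP[ax _]; have x0 := lt_trans a0 ax.
  rewrite derive1Ml.
    by rewrite powR_derive1 ?in_itv /= ?andbT // mulrA mulVf ?mul1r // gt_eqF.
  by apply: derivable_powR; rewrite in_itv /= andbT.
Qed.

Lemma integral_powR_oc (p b : R) : 0 < p -> 0 < b ->
  (\int[mu]_(x in `]0%R, b]) (x `^ (p - 1))%:E = (b `^ p / p)%:E)%E.
Proof.
(* Exhaustion by intervals away from the singularity at 0; the denominator n + 2 keeps the left end
   strictly below b already for n = 0. *)
move=> p0 b0; pose F n : set R := `[b / n.+2%:R, b]%classic.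
have bn n : 0 < b / n.+2%:R by rewrite divr_gt0.
have mpow : measurable_fun [set: R] (fun x : R => (x `^ (p - 1))%:E).
  by apply/measurable_EFinP; exact: measurable_powR.
apply/eqP; rewrite eq_le; apply/andP; split.
  have -> : `]0, b]%classic = \bigcup_n F n :> set R.
    apply/seteqP; split => [x|x [n _]]; rewrite /F /= !in_itv /=; last first.
      by move=> /andP[nx ->]; rewrite andbT (lt_le_trans _ nx).
    move=> /andP[x0 xb]; exists (Num.truncn (b / x)) => //=; rewrite in_itv /= xb andbT.
    rewrite ler_pdivrMr // mulrC -ler_pdivrMr //; apply/ltW/(lt_trans (truncnS_gt _)).
    by rewrite ltr_nat.
  have cvgF := @ge0_nondecreasing_set_cvg_integral _ (measurableTypeR R) _ F
    (fun x => (x `^ (p - 1))%:E) mu.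
  apply: (cvge_le _ (cvgF _ _ _ _)) => //.
  - near=> n; rewrite /F integral_powR_itv //.
      by rewrite lee_fin ler_pM2r ?invr_gt0 // gerBl powR_ge0.
    by rewrite ltr_pdivrMr // ltr_pMr // ltr1n.
  - apply/nondecreasing_seqP => n; rewrite subsetEset /F => x /=; rewrite !in_itv /=.
    move=> /andP[nx ->]; rewrite andbT (le_trans _ nx) // ler_pM2l // lef_pV2 ?posrE //.
    by rewrite ler_nat.
  - by move=> n; exact: measurable_itv.
  - by move=> n; exact: measurable_funTS mpow.
  - by move=> n x _; rewrite lee_fin powR_ge0.
apply/lee_addgt0Pr => e e0.
(* Cutting the integral at this a loses a^p / p, which is at most e. *)
pose a := Num.min (b / 2) ((p * e) `^ p^-1).
have a0 : 0 < a by rewrite lt_min divr_gt0 // powR_gt0 // mulr_gt0.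
have ab : a < b by rewrite gt_min; apply/orP; left; rewrite ltr_pdivrMr // ltr_pMr // ltr1n.
have ap : a `^ p <= p * e.
  have -> : p * e = ((p * e) `^ p^-1) `^ p.
    by rewrite -powRrM mulVf ?gt_eqF // powRr1 // mulr_ge0 // ltW.
  apply: ge0_ler_powR; rewrite ?nnegrE ?powR_ge0 ?(ltW a0) ?(ltW p0) //.
  by rewrite /a ge_min lexx orbT.
apply: (@le_trans _ _ (\int[mu]_(x in `[a, b]) (x `^ (p - 1))%:E + e%:E)%E); last first.
  apply: leeD => //; apply: ge0_subset_integral => //; try exact: measurable_itv.
  - exact: measurable_funTS mpow.
  - by move=> x _; rewrite lee_fin powR_ge0.
  - by move=> x /=; rewrite !in_itv /= => /andP[ax ->]; rewrite andbT (lt_le_trans a0).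
rewrite integral_powR_itv // -EFinD lee_fin mulrBl -addrA lerDl addrC subr_ge0.
by rewrite ler_pdivrMr // mulrC.
Unshelve. all: by end_near. Qed.

End power_kernel.

Section beta_integral.
Context (R : realType).
Local Notation mu := (@lebesgue_measure R).
Implicit Types p q s t : R.

Definition beta_integral p q : \bar R :=
  (\int[mu]_r (power_kernel p (1 - r) * power_kernel q r)%:E)%E.

Lemma measurable_power_kernel_subl p t :
  measurable_fun [set: R] (fun s => power_kernel p (t - s)).
Proof.
apply: (measurableT_comp (measurable_power_kernel p)).
by apply: measurable_funB.
Qed.

Lemma integral_power_kernel_le1 p : 0 < p ->
  (\int[mu]_r ((fun r => (power_kernel p r)%:E) \_ `]0%R, 1%R]) r <= (p^-1)%:E)%E.
Proof.
move=> p0; rewrite -integral_mkcond; have -> : p^-1 = 1 `^ p / p by rewrite powR1 mul1r.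
rewrite -integral_powR_oc //.
rewrite le_eqVlt; apply/orP; left; apply/eqP; apply: eq_integral => r.
by rewrite inE /= in_itv /= => /andP[r0 _]; rewrite /power_kernel r0.
Qed.

(** Each factor is singular at one end of (0, 1) only. On the half next to the other end it is at
    most its value [c] at 1/2, kernels with exponent at most 1 being nonincreasing there, which
    leaves one integrable singularity per half. *)
Lemma beta_integral_lty p q : 0 < p <= 1 -> 0 < q <= 1 -> (beta_integral p q < +oo)%E.
Proof.
move=> /andP[p0 p1] /andP[q0 q1].
pose J p r := ((fun r => (power_kernel p r)%:E) \_ `]0%R, 1%R]) r.
have J0 k r : (0 <= J k r)%E.
  by apply: erestrict_ge0 => x _; rewrite lee_fin power_kernel_ge0.
have mJ k : measurable_fun [set: R] (J k).
  have mk : measurable_fun [set: R] (fun r => (power_kernel k r)%:E).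
    by apply/measurable_EFinP; exact: measurable_power_kernel.
  exact: (measurable_restrictT _ (measurable_itv _)).1 (measurable_funTS mk).
have mJ' k : measurable_fun [set: R] (fun r => J k (1 - r)).
  by apply: (measurableT_comp (mJ k)); apply: measurable_funB.
pose c k : R := 2^-1 `^ (k - 1).
have c0 k : 0 <= c k by exact: powR_ge0.
apply: (@le_lt_trans _ _ (\int[mu]_r ((c p)%:E * J q r + (c q)%:E * J p (1 - r)%R))%E).
  apply: ge0_le_integral => //.
  - by move=> r _; rewrite lee_fin mulr_ge0 // power_kernel_ge0.
  - apply/measurable_EFinP; apply: measurable_funM; last exact: measurable_power_kernel.
    exact: measurable_power_kernel_subl.
  - apply: emeasurable_funD; apply: emeasurable_funM => //; [exact: (mJ q)|exact: (mJ' p)].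
  move=> r _; rewrite /J !patchE.
  have [r0|r0] := ltP 0 r; last first.
    rewrite {2}/power_kernel ltNge r0 /= mulr0.
    by rewrite adde_ge0 // mule_ge0 ?lee_fin //; case: ifP => // _; rewrite lee_fin power_kernel_ge0.
  have [r1|r1] := ltP r 1; last first.
    rewrite {1}/power_kernel subr_gt0 ltNge r1 /= mul0r.
    by rewrite adde_ge0 // mule_ge0 ?lee_fin //; case: ifP => // _; rewrite lee_fin power_kernel_ge0.
  rewrite !mem_set /= ?in_itv /= ?r0 ?(ltW r1) ?subr_gt0 ?r1 ?lerBlDr ?lerDl ?(ltW r0) //.
  rewrite -!EFinM -EFinD lee_fin.
  have P (k x : R) : 0 < k -> k <= 1 -> 2^-1 <= x -> power_kernel k x <= c k.
    move=> k0 k1 x1; have x0 : 0 < x by apply: lt_le_trans x1; rewrite invr_gt0.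
    rewrite /power_kernel x0 /c -(opprB 1 k) !(powRN _ (1 - k)).
    rewrite lef_pV2 ?posrE ?powR_gt0 ?invr_gt0 //.
    by apply: ge0_ler_powR; rewrite ?nnegrE ?subr_ge0 ?(ltW x0) ?invr_ge0.
  have [r2|/ltW r2] := leP r 2^-1.
    apply: ler_wpDr; first by rewrite mulr_ge0 ?power_kernel_ge0.
    by apply: ler_wpM2r; [exact: power_kernel_ge0|apply: P => //; lra].
  apply: ler_wpDl; first by rewrite mulr_ge0 ?power_kernel_ge0.
  by rewrite mulrC; apply: ler_wpM2r; [exact: power_kernel_ge0|apply: P].
rewrite ge0_integralD //.
- rewrite ge0_integralZl; [|by []|exact: mJ|by []|by rewrite lee_fin].
  rewrite ge0_integralZl; [|by []|exact: mJ'|by []|by rewrite lee_fin].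
  rewrite (@ge0_integral_subl _ _ (J p)) //.
  rewrite lte_add_pinfty // lte_mul_pinfty ?lee_fin //.
    by apply: le_lt_trans (integral_power_kernel_le1 q0) _; rewrite ltry.
  by apply: le_lt_trans (integral_power_kernel_le1 p0) _; rewrite ltry.
- by move=> r _; rewrite mule_ge0 ?lee_fin.
- by apply: emeasurable_funM => //; exact: (mJ q).
- by move=> r _; rewrite mule_ge0 ?lee_fin.
- by apply: emeasurable_funM => //; exact: (mJ' p).
Qed.

(** The kernels are homogeneous of degrees -p and p - 1, which add up to -1; the Jacobian t - s
    cancels this, so the value depends on neither s nor t. For this reason a second convolution
    turns an Abel integral into an ordinary one. *)
Lemma beta_convolution p s t : s < t ->
  (\int[mu]_r (power_kernel (1 - p) (t - r) * power_kernel p (r - s))%:E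
   = beta_integral (1 - p) p)%E.
Proof.
move=> st; have ts : 0 < t - s by rewrite subr_gt0.
rewrite -(@ge0_integral_affine _ (t - s) s); last 3 first.
- by [].
- apply/measurable_EFinP; apply: measurable_funM.
    exact: measurable_power_kernel_subl.
  apply: (measurableT_comp (measurable_power_kernel p)).
  by apply: measurable_funB.
- by move=> x; rewrite lee_fin mulr_ge0 // power_kernel_ge0.
rewrite /beta_integral.
have m0 : measurable_fun [set: R] (fun r : R => (power_kernel (1 - p) (1 - r) * power_kernel p r)%:E).
  apply/measurable_EFinP; apply: measurable_funM; last exact: measurable_power_kernel.
  exact: measurable_power_kernel_subl.
rewrite (eq_integral (fun r : measurableTypeR R => ((t - s)^-1)%:E *
    (power_kernel (1 - p) (1 - r) * power_kernel p r)%:E)%E).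
  rewrite ge0_integralZl //; last 2 first.
  - by move=> r _; rewrite lee_fin mulr_ge0 // power_kernel_ge0.
  - by rewrite lee_fin invr_ge0 ltW.
  by rewrite muleA -EFinM divff ?mul1e // gt_eqF.
move=> r _.
rewrite (_ : t - ((t - s) * r + s) = (t - s) * (1 - r)); last by ring.
rewrite addrK !power_kernelM // -EFinM; congr (_%:E).
rewrite mulrACA -powRD; last by apply/implyP => _; rewrite gt_eqF.
by rewrite (_ : 1 - p - 1 + (p - 1) = -1) ?powR_inv1 ?ltW //; ring.
Qed.

End beta_integral.

Section abel_inversion.
Context (R : realType).
Local Notation mu := (@lebesgue_measure R).

(** On a bounded interval |w| <= 1 + w^2. *)
Lemma L2_integrable (w : R -> R) (a b c : R) : a <= b <= c ->
  L2 mu `]a, c[ w -> mu.-integrable `]a, b[ (EFin \o w).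
Proof.
move=> /andP[ab bc] [mw iw2].
have sub : `]a, b[ `<=` `]a, c[.
  by move=> x /=; rewrite !in_itv /= => /andP[-> xb]; apply: lt_le_trans bc.
have mw' : measurable_fun `]a, b[ w by apply: measurable_funS mw => //; exact: measurable_itv.
have iw2' : mu.-integrable `]a, b[ (fun x => (w x ^+ 2)%:E).
  by apply: integrableS iw2 => //; exact: measurable_itv.
have i1 : mu.-integrable `]a, b[ (cst 1%:E).
  apply/integrableP; split => //.
  rewrite /= normr1 integral_cst //= mul1e lebesgue_measure_itv /= lte_fin.
  by case: ifP; rewrite ?ltry.
apply: (le_integrable _ _ _ (integrableD _ i1 iw2')) => //.
- exact/measurable_EFinP.
- move=> x _; rewrite /= lee_fin [leRHS]ger0_norm ?addr_ge0 ?sqr_ge0 //.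
  have := sqr_ge0 (`|w x| - 1); rewrite -[w x ^+ 2]real_normK ?num_real //.
  have := normr_ge0 (w x); nra.
Qed.

Variables (alpha T : R) (f w : R -> R).
Hypothesis alpha01 : 0 < alpha < 1.
Hypothesis w2 : L2 mu `]0, T[ w.
Hypothesis fE : {ae mu, forall t, t \in `]0, T[ -> frac_integral alpha w t = f t}.
Hypothesis mf : measurable_fun `]0, T[ f.

(** For 0 < alpha < 1 this number is Gamma(1 - alpha), by the Beta-Gamma relation. *)
Definition abel_const (alpha : R) : R :=
  (gamma_fun alpha)^-1 * fine (beta_integral (1 - alpha) alpha).

Lemma abel_const_ge0 (k : R) : 0 <= abel_const k.
Proof.
apply: mulr_ge0.
  rewrite invr_ge0 /gamma_fun; apply: Rintegral_ge0 => x _.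
  by rewrite mulr_ge0 ?powR_ge0 ?expR_ge0.
apply: fine_ge0; apply: integral_ge0 => x _.
by rewrite lee_fin mulr_ge0 ?power_kernel_ge0.
Qed.

(** Fubini for the double integrand [G]: integrating in the second variable first reproduces f up to
    the factor 1 / Gamma(alpha); integrating in the first variable first yields the constant of
    [beta_convolution] times w. *)
Lemma abel_integral (tau : R) : 0 < tau <= T ->
  \int[mu]_(t in `]0, tau[) (power_kernel (1 - alpha) (tau - t) * f t) =
  abel_const alpha * \int[mu]_(t in `]0, tau[) w t.
Proof.
move=> /andP[tau0 tauT]; have /andP[al0 al1] := alpha01.
have iw : mu.-integrable `]0, tau[ (EFin \o w).
  by apply: (@L2_integrable _ _ _ T) => //; rewrite ltW.
pose wt : measurableTypeR R -> R := w \_ `]0, tau[.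
have iwt : mu.-integrable setT (EFin \o wt).
  by rewrite /wt -restrict_EFin; apply/integrable_restrict => //=; rewrite setTI.
have mwt : measurable_fun [set: R] wt.
  by have /integrableP[/measurable_EFinP] := iwt.
pose G (z : measurableTypeR R * measurableTypeR R) : \bar R :=
  (power_kernel (1 - alpha) (tau - z.1) * (power_kernel alpha (z.1 - z.2) * wt z.2))%:E.
have mG : measurable_fun setT G.
  apply/measurable_EFinP; apply: measurable_funM.
    apply: (measurableT_comp (measurable_power_kernel _)).
    by apply: measurable_funB => //; exact: measurable_fst.
  apply: measurable_funM.
    apply: (measurableT_comp (measurable_power_kernel _)).
    by apply: measurable_funB; [exact: measurable_fst|exact: measurable_snd].
  by apply: (measurableT_comp mwt); exact: measurable_snd.
pose B := beta_integral (1 - alpha) alpha.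
have Bfin : B \is a fin_num.
  rewrite ge0_fin_numE.
    by apply: beta_integral_lty; lra.
  by apply: integral_ge0 => x _; rewrite lee_fin mulr_ge0 ?power_kernel_ge0.
have mK (s : R) : measurable_fun [set: R]
    (fun r : R => power_kernel (1 - alpha) (tau - r) * power_kernel alpha (r - s)).
  apply: measurable_funM; first exact: measurable_power_kernel_subl.
  apply: (measurableT_comp (measurable_power_kernel alpha)).
  by apply: measurable_funB.
(* The premise restricts s < tau to nonzero h: [beta_convolution] requires s < tau, and for h = 0
   both sides vanish. *)
have iK (s h : R) : (h != 0 -> s < tau) ->
    (\int[mu]_r (power_kernel (1 - alpha) (tau - r) * (power_kernel alpha (r - s) * h))%:E
     = h%:E * B)%E.
  have [->|h0 /(_ isT) st] := eqVneq h 0.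
    by rewrite mul0e => _; apply: integral0_eq => r _; rewrite !mulr0.
  rewrite muleC /B -(beta_convolution alpha st) -integralZr //.
    by apply: eq_integral => r _; rewrite -EFinM mulrA.
  apply/integrableP; split; first by apply/measurable_EFinP; exact: mK.
  under eq_integral do rewrite gee0_abs ?lee_fin ?mulr_ge0 ?power_kernel_ge0 //.
  by rewrite beta_convolution // -/B -ge0_fin_numE //; apply: integral_ge0 => x _; rewrite lee_fin mulr_ge0 ?power_kernel_ge0.
have wt0 s : wt s != 0 -> s < tau.
  rewrite /wt patchE; case: ifPn; last by rewrite eqxx.
  by rewrite inE /= in_itv /= => /andP[].
(* The kernels are nonnegative, so absolute values affect [wt] only and [iK] with h = |wt s|
   computes the iterated integral exactly. *)
have iG : (mu \x mu)%E.-integrable setT G.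
  apply/(integrable21ltyP _ _ mG).
  rewrite (eq_integral (fun s => `|wt s|%:E * B)%E).
    have /integrableP[mabs] := integrable_abse iwt.
    rewrite (ge0_integralZr _ measurableT mabs); last 2 first.
    - by move=> x _; exact: abse_ge0.
    - by apply: integral_ge0 => x _; rewrite lee_fin mulr_ge0 ?power_kernel_ge0.
    rewrite (eq_integral (abse \o (EFin \o wt))); last first.
      by move=> x _; rewrite /= normr_id.
    have h0 : (0 <= \int[mu]_x (abse \o (EFin \o wt)) x)%E.
      by apply: integral_ge0 => x _; exact: abse_ge0.
    by move=> H; rewrite lte_mul_pinfty ?ge0_fin_numE // ltey_eq Bfin.
  move=> s _; rewrite -(iK s); last by rewrite normr_eq0; exact: wt0.
  apply: eq_integral => t _; rewrite /G /= !normrM.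
  by rewrite !(ger0_norm (power_kernel_ge0 _ _)).
have eqF : (\int[mu]_t fubini_F mu G t = \int[mu]_s fubini_G mu G s)%E.
  by rewrite integral12_prod_meas1 // integral21_prod_meas1.
have GE s : fubini_G mu G s = ((wt s)%:E * B)%E.
  by rewrite /fubini_G /G /= iK //; exact: wt0.
have rhsE : (\int[mu]_s fubini_G mu G s = (\int[mu]_(t in `]0%R, tau[) (w t)%:E) * B)%E.
  under eq_integral do rewrite GE.
  rewrite -(fineK Bfin) integralZr //; congr (_ * _)%E.
  by rewrite [RHS]integral_mkcond; apply: eq_integral => s _; rewrite /wt /= !patchE; case: ifP.
pose c0 := (gamma_fun alpha)^-1.
have lhsE : (\int[mu]_(t in `]0%R, tau[) (power_kernel (1 - alpha) (tau - t) * f t)%:E =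
   c0%:E * \int[mu]_t fubini_F mu G t)%E.
  rewrite -integralZl //; last exact: integrable_fubini_F.
  rewrite [LHS]integral_mkcond; apply: ae_eq_integral; first exact: measurableT.
  - apply: (measurable_restrictT _ (measurable_itv _)).1; apply/measurable_EFinP.
    apply: measurable_funM; first by apply: measurable_funTS; exact: measurable_power_kernel_subl.
    apply: (measurable_funS _ _ mf); first exact: measurable_itv.
    by move=> t; rewrite /= !in_itv /= => /andP[-> tt]; exact: lt_le_trans tauT.
  - by apply: measurable_funeM; exact: (measurable_fubini_F iG).
  have FF := ae_filter_ringOfSetsType (@lebesgue_measure R : {measure set (measurableTypeR R) -> \bar R}).
  have aeI := ae_integrable1 iG.
  apply: (@filterS2 _ _ FF _ _ _ _ fE aeI) => t ft intt _.
  rewrite patchE /fubini_F /G /=; case: ifPn; last first.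
    rewrite notin_setE /= in_itv /= => /negP tn; rewrite integral0_eq ?mule0 // => s _.
    have [ttau|ttau] := ltP t tau; last first.
      by rewrite [power_kernel (1 - _) _]/power_kernel subr_gt0 ltNge ttau /= mul0r.
    rewrite /wt patchE; case: ifPn; last by rewrite !mulr0.
    rewrite inE /= in_itv /= => /andP[s0 _].
    rewrite ttau andbT -leNgt in tn.
    by rewrite [power_kernel alpha _]/power_kernel subr_gt0 ltNge (le_trans tn (ltW s0)) mul0r mulr0.
  rewrite inE /= in_itv /= => /andP[t0 ttau].
  (* For almost every t the section of [G] is integrable; division by the nonzero factor K makes the
     Abel integrand [h] integrable, so its integral is finite and can be identified with the
     real-valued [frac_integral]. *)
  set K := power_kernel _ _; have K0 : K != 0.
    by rewrite /K /power_kernel subr_gt0 ttau gt_eqF // powR_gt0 // subr_gt0.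
  pose h (s : measurableTypeR R) := (power_kernel alpha (t - s) * wt s)%:E.
  have ih : mu.-integrable setT h.
    have := integrableZl measurableT K^-1 intt.
    apply: eq_integrable => // s _.
    by rewrite /G /h /= -/K -EFinM mulKf.
  transitivity (c0%:E * (K%:E * \int[mu]_s h s))%E; last first.
    by congr (_ * _)%E; rewrite -integralZl //; apply: eq_integral => s _; rewrite -EFinM.
  have fh : (\int[mu]_s h s)%E \is a fin_num by exact: integrable_fin_num.
  have -> : f t = c0 * fine (\int[mu]_s h s)%E.
    rewrite -ft ?in_itv /= ?t0 ?(lt_le_trans ttau) // /frac_integral; congr (_ * _).
    rewrite /Rintegral integral_mkcond; congr (fine _); apply: eq_integral => s _.
    rewrite patchE /h; case: ifPn.
      rewrite inE /= in_itv /= => /andP[s0 st].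
      rewrite /wt patchE mem_set /= ?in_itv /= ?s0 ?(lt_trans st) //.
      by rewrite /power_kernel subr_gt0 st.
    rewrite notin_setE /= in_itv /= => /negP sn.
    have [st|st] := ltP s t; last first.
      by rewrite /power_kernel subr_gt0 ltNge st mul0r.
    rewrite st andbT in sn.
    by rewrite /wt patchE memNset ?mulr0 //= in_itv /= (negbTE sn).
  by rewrite -{2}(fineK fh) -!EFinM mulrCA.
rewrite /Rintegral lhsE eqF rhsE /abel_const.
have fw : (\int[mu]_(t in `]0%R, tau[) (w t)%:E)%E \is a fin_num by exact: integrable_fin_num.
by rewrite -(fineK fw) -(fineK Bfin) -!EFinM /= -mulrA; congr (_ * _); rewrite mulrC.
Qed.

End abel_inversion.

(** * Integrals against the power kernel and the estimates at a minimum *)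

Section weakly_singular_integral.
Context (R : realType).
Local Notation mu := (@lebesgue_measure R).
Variables (p : R) (p0 : 0 < p).

Lemma integral_power_kernel_subl (x : R) (B : set R) : measurable B ->
  (\int[mu]_(t in [set t | B (x - t)%R]) (power_kernel p (x - t)%R)%:E
   = \int[mu]_(t in B) (power_kernel p t)%:E)%E.
Proof.
move=> mB; pose g (s : R) := ((fun s => (power_kernel p s)%:E) \_ B) s.
have mg : measurable_fun [set: R] g.
  have mpow : measurable_fun [set: R] (fun x : R => (power_kernel p x)%:E).
    by apply/measurable_EFinP; exact: measurable_power_kernel.
  exact: (measurable_restrictT _ mB).1 (measurable_funTS mpow).
have g0 s : (0 <= g s)%E.
  by apply: erestrict_ge0 => y _; rewrite lee_fin power_kernel_ge0.
rewrite [RHS]integral_mkcond -[RHS](@ge0_integral_subl _ x g mg g0).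
rewrite integral_mkcond; apply: eq_integral => t _; rewrite /g !patchE /=.
by have [tB|tB] := pselect (B (x - t)); [rewrite !mem_set|rewrite !memNset].
Qed.

Lemma integral_power_kernel_oc (c : R) : 0 < c ->
  (\int[mu]_(t in `]0%R, c]) (power_kernel p t)%:E = (c `^ p / p)%:E)%E.
Proof.
move=> c0; rewrite -integral_powR_oc //; apply: eq_integral => s.
by rewrite inE /= in_itv /= => /andP[s0 _]; rewrite /power_kernel s0.
Qed.

Lemma integral_power_kernel_oo (x : R) : 0 < x ->
  (\int[mu]_(t in `]0%R, x[) (power_kernel p (x - t))%:E = (x `^ p / p)%:E)%E.
Proof.
move=> x0; rewrite -(integral_power_kernel_oc x0).
rewrite -integral_itv_bndo_bndc.
  rewrite -(integral_power_kernel_subl x (measurable_itv _)).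
  congr (integral _ _ _); apply/seteqP; split => t /=; rewrite !in_itv /=; lra.
by apply/measurable_EFinP; apply: measurable_funTS; exact: measurable_power_kernel.
Qed.

Lemma integral_power_kernel_co (x c : R) : 0 < c ->
  (\int[mu]_(t in `[(x - c)%R, x[) (power_kernel p (x - t))%:E = (c `^ p / p)%:E)%E.
Proof.
move=> c0; rewrite -(integral_power_kernel_oc c0).
rewrite -(integral_power_kernel_subl x (measurable_itv _)).
congr (integral _ _ _); apply/seteqP; split => t /=; rewrite !in_itv /=; lra.
Qed.

Lemma integrable_power_kernel_oo (x : R) : 0 < x ->
  mu.-integrable `]0, x[ (fun t => (power_kernel p (x - t))%:E).
Proof.
move=> x0; apply/integrableP; split.
  by apply/measurable_EFinP; apply: measurable_funTS; exact: measurable_power_kernel_subl.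
under eq_integral do rewrite gee0_abs ?lee_fin ?power_kernel_ge0 //.
by rewrite integral_power_kernel_oo // ltry.
Qed.

Lemma integrable_power_kernelM (A : set (measurableTypeR R)) (x M : R) (f : R -> R) :
  measurable A -> mu.-integrable A (fun t => (power_kernel p (x - t))%:E) ->
  measurable_fun A f -> (forall t, A t -> `|f t| <= M) ->
  mu.-integrable A (fun t => (power_kernel p (x - t) * f t)%:E).
Proof.
move=> mA iA mf fM.
have iM := integrableZl mA M iA.
apply: (le_integrable mA _ _ iM) => //.
  apply/measurable_EFinP; apply: measurable_funM => //.
  by apply: measurable_funTS; exact: measurable_power_kernel_subl.
move=> t At; rewrite /= lee_fin !normrM mulrC.
rewrite ler_wpM2r //; apply: le_trans (fM t At) _; exact: ler_norm.
Qed.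

Lemma power_kernel_decr (x y : R) : p <= 1 -> 0 < x -> x <= y ->
  power_kernel p y <= power_kernel p x.
Proof.
move=> p1 x0 xy; have y0 := lt_le_trans x0 xy.
rewrite /power_kernel x0 y0 -(opprB 1 p) !(powRN _ (1 - p)).
rewrite lef_pV2 ?posrE ?powR_gt0 //.
by apply: ge0_ler_powR; rewrite ?nnegrE ?subr_ge0 ?(ltW x0) ?(ltW y0).
Qed.

(* Extremum principle: the integrals at [t0] and [t0 - eta] are compared through
   [f = k + (f - k)], the kernel being decreasing. *)
Lemma power_kernel_increment (f : R -> R) (t0 eta k E M : R) :
  p <= 1 -> 0 < eta < t0 -> measurable_fun `]0, t0[ f ->
  (forall t, 0 < t < t0 -> `|f t| <= M) ->
  (forall t, 0 < t < t0 -> k <= f t) ->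
  (forall t, t0 - eta <= t < t0 -> f t <= k + E) ->
  \int[mu]_(t in `]0, t0[) (power_kernel p (t0 - t) * f t) -
  \int[mu]_(t in `]0, t0 - eta[) (power_kernel p (t0 - eta - t) * f t)
  <= k * ((t0 `^ p - (t0 - eta) `^ p) / p) + E * (eta `^ p / p).
Proof.
move=> p1 /andP[eta0 etat] mf fM fk fE; set x1 := t0 - eta.
have x10 : 0 < x1 by rewrite subr_gt0.
have t00 : 0 < t0 by lra.
have mA : measurable (`]0, x1[%classic : set (measurableTypeR R)) by exact: measurable_itv.
have mB : measurable (`[x1, t0[%classic : set (measurableTypeR R)) by exact: measurable_itv.
have mC : measurable (`]0, t0[%classic : set (measurableTypeR R)) by exact: measurable_itv.
have AB : `]0, t0[%classic = `]0, x1[ `|` `[x1, t0[ :> set R.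
  apply/seteqP; split => t /=; rewrite !in_itv /=.
    by move=> /andP[-> ->]; have [|] := ltP t x1; [left|right].
  by move=> [|] /andP[]; rewrite /x1 => h1 h2; apply/andP; split; lra.
have subA : `]0, x1[ `<=` `]0, t0[ by rewrite AB; left.
have subB : `[x1, t0[ `<=` `]0, t0[ by rewrite AB; right.
have it0 := integrable_power_kernel_oo t00.
have iA0 := integrableS mC mA subA it0.
have iB0 := integrableS mC mB subB it0.
have iA1 := integrable_power_kernel_oo x10.
have mfA : measurable_fun `]0, x1[ f by exact: measurable_funS mf.
have mfB : measurable_fun `[x1, t0[ f by exact: measurable_funS mf.
have fMA t : `]0, x1[%classic t -> `|f t| <= M.
  by move=> /subA /=; rewrite in_itv /=; exact: fM.
have fMB t : `[x1, t0[%classic t -> `|f t| <= M.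
  by move=> /subB /=; rewrite in_itv /=; exact: fM.
have ifA0 := integrable_power_kernelM mA iA0 mfA fMA.
have ifB0 := integrable_power_kernelM mB iB0 mfB fMB.
have ifA1 := integrable_power_kernelM mA iA1 mfA fMA.
have dAB : [disjoint `]0, x1[%classic & `[x1, t0[%classic].
  apply/disj_set2P; apply/seteqP; split => t //= []; rewrite !in_itv /=; lra.
have JB : \int[mu]_(t in `[x1, t0[) power_kernel p (t0 - t) = eta `^ p / p.
  by rewrite /Rintegral integral_power_kernel_co.
have J1 : \int[mu]_(t in `]0, x1[) power_kernel p (x1 - t) = x1 `^ p / p.
  by rewrite /Rintegral integral_power_kernel_oo.
have J0 : \int[mu]_(t in `]0, x1[) power_kernel p (t0 - t) = (t0 `^ p - eta `^ p) / p.
  have := @Rintegral_setU _ _ _ mu `]0, x1[%classic `[x1, t0[%classic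
    (fun t => power_kernel p (t0 - t)) mA mB.
  rewrite -AB => /(_ it0 dAB); rewrite JB /Rintegral integral_power_kernel_oo //= => H.
  by rewrite mulrBl H addrK.
have ifC : mu.-integrable (`]0, x1[ `|` `[x1, t0[) (fun t => (power_kernel p (t0 - t) * f t)%:E).
  by rewrite -AB; apply: (@integrable_power_kernelM _ _ M).
rewrite AB (Rintegral_setU mA mB ifC dAB).
rewrite addrAC -RintegralB //.
(* On the first interval the difference of the kernels is nonpositive, so the lower bound k for f
   gives an upper bound; on the last one the kernel is nonnegative and f <= k + E is used. *)
apply: (@le_trans _ _ (\int[mu]_(t in `]0, x1[)
    (k * (power_kernel p (t0 - t) - power_kernel p (x1 - t))) +
  \int[mu]_(t in `[x1, t0[) ((k + E) * power_kernel p (t0 - t)))).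
  apply: lerD; apply: le_Rintegral => //.
  - exact: (integrableB mA ifA0 ifA1).
  - exact: (integrableZl mA k (integrableB mA iA0 iA1)).
  - move=> t At; have := At; rewrite /= in_itv /= => /andP[t1 t2].
    rewrite -mulrBl [leRHS]mulrC; apply: ler_wnM2l.
      by rewrite subr_le0; apply: power_kernel_decr; rewrite ?subr_gt0 // lerB // gerBl ltW.
    by apply: fk; rewrite t1 (lt_trans t2) // gtrBl.
  - exact: (integrableZl mB (k + E) iB0).
  - move=> t; rewrite /= in_itv /= => /andP[t1 t2]; rewrite mulrC.
    by rewrite ler_wpM2r ?power_kernel_ge0 // fE // t1.
rewrite RintegralZl //; last exact: (integrableB mA iA0 iA1).
rewrite RintegralB // RintegralZl // J0 J1 JB.
rewrite le_eqVlt; apply/orP; left; apply/eqP; field; exact: lt0r_neq0.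
Qed.

End weakly_singular_integral.

(** Mean value theorem, the derivative of x^p / p being nonincreasing for p <= 1. It provides the
    term linear in eta that must beat an error of order eta^(2 - alpha). *)
Lemma powR_increment_ge (R : realType) (p x y : R) : 0 < p <= 1 -> 0 < x < y ->
  y `^ (p - 1) * (y - x) <= (y `^ p - x `^ p) / p.
Proof.
move=> /andP[p0 p1] /andP[x0 xy]; have y0 := lt_trans x0 xy.
have [||c] := @MVT R (@powR R ^~ p) (fun t => p * t `^ (p - 1)) x y xy.
- by move=> t; rewrite in_itv /= => /andP[xt _]; apply: is_derive1_powR; exact: lt_trans xt.
- apply: derivable_within_continuous => t; rewrite in_itv /= => /andP[xt _].
  by apply: derivable_powR; rewrite in_itv /= andbT (lt_le_trans x0).
rewrite in_itv /= => /andP[xc cy] ->; have c0 := lt_trans x0 xc.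
rewrite (_ : _ / p = c `^ (p - 1) * (y - x)); last by field; exact: lt0r_neq0.
rewrite ler_pM2r ?subr_gt0 //.
have := @power_kernel_decr R p c y p1 c0 (ltW cy).
by rewrite /power_kernel y0 c0.
Qed.

Lemma ae_le_Rintegral (R : realType) (D : set (measurableTypeR R)) (f g : R -> R) :
  measurable D -> (@lebesgue_measure R).-integrable D (EFin \o f) -> (@lebesgue_measure R).-integrable D (EFin \o g) ->
  {ae (@lebesgue_measure R), forall t, D t -> f t <= g t} ->
  \int[@lebesgue_measure R]_(t in D) f t <= \int[@lebesgue_measure R]_(t in D) g t.
Proof.
move=> mD iF iG [N [mN N0 fgN]].
have mDN : measurable (D `\` N) by exact: measurableD.
have DN : D `\` N `<=` D by exact: subDsetl.
have ndF := negligible_integral mN mD iF N0; have ndG := negligible_integral mN mD iG N0.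
rewrite /= in ndF ndG; rewrite /Rintegral ndF ndG.
apply: le_Rintegral => //; try exact: (integrableS mD mDN DN).
move=> t [Dt Nt]; apply: contrapT => nfg; apply: Nt; apply: fgN => /=.
by move=> /(_ Dt).
Qed.

Section fractional_extremum.
Context (R : realType).
Local Notation mu := (@lebesgue_measure R).
Variables (alpha T : R) (f w : R -> R).
Hypothesis alpha01 : 0 < alpha < 1.
Hypothesis w2 : L2 mu `]0, T[ w.
Hypothesis fE : {ae mu, forall t, t \in `]0, T[ -> frac_integral alpha w t = f t}.
Hypothesis mf : measurable_fun `]0, T[ f.

(** As w >= 0 near t0, the integral of w does not decrease there, whereas f >= k with k negative
    pulls the convolution down by at least kappa * t0^(-alpha) * eta, up to the error from the last
    interval. Division by eta leaves an inequality that fails for kappa > 0 and small eta. The bound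
    [kappa] is separate from the minimum level [k], which will vary with x. *)
Lemma fractional_extremum (t0 eta kappa L M : R) :
  0 < eta < t0 -> t0 <= T -> 
  (forall t, 0 < t < t0 -> `|f t| <= M) ->
  (exists2 k, k <= - kappa & (forall t, 0 < t < t0 -> k <= f t) /\
    (forall t, t0 - eta <= t < t0 -> f t <= k + L * eta)) ->
  0 <= L -> {ae mu, forall t, t0 - eta < t < t0 -> 0 <= w t} ->
  kappa * t0 `^ (- alpha) <= L * (eta `^ (1 - alpha) / (1 - alpha)).
Proof.
move=> /andP[eta0 etat] t0T fM [k kk [fk fE']] L0 wge0; have /andP[al0 al1] := alpha01.
have t00 : 0 < t0 by exact: lt_trans etat.
have x10 : 0 < t0 - eta by rewrite subr_gt0.
have p0 : 0 < 1 - alpha by lra.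
have p1 : 1 - alpha <= 1 by lra.
have mft : measurable_fun `]0, t0[ f.
  apply: (measurable_funS _ _ mf); first exact: measurable_itv.
  by move=> t; rewrite /= !in_itv /= => /andP[-> /lt_le_trans]; exact.
have etat0 : 0 < eta < t0 by rewrite eta0.
have := power_kernel_increment p0 p1 etat0 mft fM fk fE'.
rewrite (abel_integral alpha01 w2 fE mf) ?t00 //.
rewrite (abel_integral alpha01 w2 fE mf) ?x10 ?(le_trans _ t0T) //; last by rewrite gerBl ltW.
rewrite -mulrBr.
have iw : mu.-integrable `]0, t0[ (EFin \o w).
  by apply: (@L2_integrable _ _ _ _ T) => //; rewrite ltW.
have wpos : 0 <= \int[mu]_(t in `]0, t0[) w t - \int[mu]_(t in `]0, t0 - eta[) w t.
  rewrite (Rintegral_itv_bndo_bndc (a := BRight 0) (r := t0 - eta)); last first.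
    apply: (@L2_integrable _ _ _ _ T) => //; lra.
  rewrite Rintegral_itvB ?bnd_simp ?gtrBl ?(ltW x10) //.
  have <- : \int[mu]_(t in `]t0 - eta, t0[) (0 : R) = 0.
    by rewrite Rintegral_cst ?mul0r //; exact: measurable_itv.
  apply: ae_le_Rintegral.
  - exact: measurable_itv.
  - exact: (@integrable0 _ _ _ mu).
  - apply: (integrableS _ _ _ iw); try exact: measurable_itv.
    by move=> t; rewrite /= !in_itv /= => /andP[xt ->]; rewrite (lt_trans x10).
  - have FF := ae_filter_ringOfSetsType (@lebesgue_measure R : {measure set (measurableTypeR R) -> \bar R}).
    by apply: (@filterS _ _ FF _ _ _ wge0) => t H; rewrite /= in_itv.
move=> H; have {}H := le_trans (mulr_ge0 (abel_const_ge0 alpha) wpos) H.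
have /andP[x1 x2] : 0 < t0 - eta < t0 by rewrite x10 gtrBl.
have D : t0 `^ (- alpha) * eta <= (t0 `^ (1 - alpha) - (t0 - eta) `^ (1 - alpha)) / (1 - alpha).
  have := @powR_increment_ge R (1 - alpha) (t0 - eta) t0.
  by rewrite p0 p1 x1 x2 addrC !addrA addNr add0r subKr => /(_ isT isT).
set Q := (_ / _) in D H; set S := eta `^ _ / _ in H *.
have Q0 : 0 <= Q by apply: le_trans D; rewrite mulr_ge0 ?powR_ge0 // ltW.
have [kn|kp] := leP kappa 0.
  apply: (@le_trans _ _ 0); first by rewrite mulr_le0_ge0 // powR_ge0.
  by rewrite mulr_ge0 // divr_ge0 ?powR_ge0 // ltW.
have : kappa * Q <= L * eta * S.
  rewrite -subr_ge0 addrC; apply: le_trans H _; rewrite lerD2r.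
  by rewrite -mulNr ler_wpM2r.
move=> /(le_trans (ler_wpM2l (ltW kp) D)).
by rewrite mulrA [L * eta * S]mulrAC ler_pM2r.
Qed.

(** The upper bound on f makes the convolution negative of order tau^(1 - alpha), while w >= - C
    allows only order tau; for kappa > 0 the two conflict as tau tends to 0. *)
Lemma fractional_initial (tau kappa C M : R) :
  0 < tau <= T -> (forall t, 0 < t < tau -> `|f t| <= M) ->
  (forall t, 0 < t < tau -> f t <= - kappa) ->
  {ae mu, forall t, 0 < t < tau -> - C <= w t} ->
  kappa * (tau `^ (1 - alpha) / (1 - alpha)) <= abel_const alpha * C * tau.
Proof.
move=> /andP[tau0 tauT] fM fk wC; have /andP[al0 al1] := alpha01.
have p0 : 0 < 1 - alpha by lra.
have mD : measurable (`]0, tau[%classic : set (measurableTypeR R)) by exact: measurable_itv.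
have mft : measurable_fun `]0, tau[ f.
  apply: (measurable_funS _ _ mf); first exact: measurable_itv.
  by move=> t; rewrite /= !in_itv /= => /andP[-> /lt_le_trans]; exact.
have iK := integrable_power_kernel_oo p0 tau0.
have fM' t : `]0, tau[%classic t -> `|f t| <= M by rewrite /= in_itv /=; exact: fM.
have iKf := integrable_power_kernelM mD iK mft fM'.
have H1 : \int[mu]_(t in `]0, tau[) (power_kernel (1 - alpha) (tau - t) * f t) <=
    - kappa * (tau `^ (1 - alpha) / (1 - alpha)).
  have <- : \int[mu]_(t in `]0, tau[) (power_kernel (1 - alpha) (tau - t)) =
      tau `^ (1 - alpha) / (1 - alpha) by rewrite /Rintegral integral_power_kernel_oo.
  rewrite -RintegralZl //; apply: le_Rintegral => //; first exact: (integrableZl mD (- kappa) iK).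
  move=> t; rewrite /= in_itv /= => /fk fkt.
  by rewrite [leRHS]mulrC ler_wpM2l // power_kernel_ge0.
rewrite (abel_integral alpha01 w2 fE mf) ?tau0 // in H1.
have H2 : - C * tau <= \int[mu]_(t in `]0, tau[) w t.
  have <- : \int[mu]_(t in `]0, tau[) (- C) = - C * tau.
    rewrite Rintegral_cst //; congr (_ * _).
    transitivity (fine (mu `]0, tau[%classic)) => //.
    by rewrite lebesgue_measure_itv /= lte_fin tau0 oppr0 adde0.
  apply: ae_le_Rintegral => //.
  - apply/integrableP; split; first exact: (measurable_cst (- C)%:E).
    apply: (@le_lt_trans _ _ (\int[mu]_(x in `]0%R, tau[) cst (`|- C|%R)%:E x)%E) => //.
    rewrite integral_cst //.
    have E : lebesgue_measure (`]0, tau[%classic : set R) = tau%:E.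
      by rewrite lebesgue_measure_itv /= lte_fin tau0 oppr0 adde0.
    by rewrite [X in (_ * X)%E]E -EFinM ltry.
  - by apply: (@L2_integrable _ _ _ _ T) => //; rewrite ltW.
have := le_trans (ler_wpM2l (abel_const_ge0 alpha) H2) H1.
by rewrite !mulNr mulrN lerN2 => H; rewrite -mulrA.
Qed.

End fractional_extremum.

(** * Functions continuous up to the boundary *)

Lemma compact_continuous_bounded (R : realType) (S : topologicalType) (K : set S) (f : S -> R) :
  compact K -> {within K, continuous f} ->
  exists2 M : R, 0 < M & forall x, K x -> `|f x| <= M.
Proof.
move=> cK cf.
have /ex_strict_bound_gt0[M M0 H] : bounded_set (f @` K).
  exact/compact_bounded/continuous_compact.
by exists M => // x Kx; apply/ltW/H; exists x.
Qed.

Section Ck_spaces.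
Context (R : realType) (d : nat).
Variable Omega : set 'rV[R]_d.
Hypothesis oOmega : open Omega.
Hypothesis cOmega : compact (closure Omega).
Implicit Types (f g : 'rV[R]_d -> R) (x y : 'rV[R]_d) (s : seq 'I_d).

Lemma near_Omega x : Omega x -> \forall y \near x, Omega y.
Proof. by move=> Ox; exact: open_nbhs_nbhs. Qed.

Lemma Ck_closure_bounded k f s : Ck_closure k Omega f -> (size s <= k)%N ->
  exists2 M : R, 0 < M & forall x, Omega x -> `|pders s f x| <= M.
Proof.
move=> [_ H] sk; have [_ [g cg gE]] := H s sk.
have [M M0 HM] := compact_continuous_bounded cOmega cg.
by exists M => // x Ox; rewrite -gE //; apply/HM/subset_closure.
Qed.

Lemma Ck_closure_continuous k f s x : Ck_closure k Omega f -> (size s <= k)%N ->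
  Omega x -> {for x, continuous (pders s f)}.
Proof.
move=> [_ H] sk Ox; have [_ [g cg gE]] := H s sk.
have gf : \forall y \near x, g y = pders s f y.
  by apply: filterS (near_Omega Ox) => y; exact: gE.
apply: near_eq_continuous_at gf _.
have cgO : {within Omega, continuous g}.
  by apply: continuous_subspaceW cg; exact: subset_closure.
by rewrite continuous_open_subspace // in cgO; apply: cgO; rewrite inE.
Qed.

Lemma Ck_closure_C1 k f s x : Ck_closure k Omega f -> (size s < k)%N ->
  Omega x -> C1_at (pders s f) x.
Proof.
move=> fk sk Ox; split.
  apply: filterS (near_Omega Ox) => y Oy i; have [_ H] := fk.
  by have [H1 _] := H s (ltnW sk); exact: H1.
by move=> i; apply: (Ck_closure_continuous (s := i :: s) fk).
Qed.

Lemma Ck_closure_C2 f x : Ck_closure 2 Omega f -> Omega x -> C2_at f x.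
Proof.
move=> f2 Ox; split.
  by apply: filterS (near_Omega Ox) => y Oy; exact: (Ck_closure_C1 (s := [::]) f2).
by move=> i; exact: (Ck_closure_C1 (s := [:: i]) f2).
Qed.

Lemma pders_sub k f g s x : Ck_closure k Omega f -> Ck_closure k Omega g ->
  (size s <= k)%N -> Omega x ->
  pders s (fun y => f y - g y) x = pders s f x - pders s g x.
Proof.
move=> fk gk; elim: s x => [//|i s IH] x sk Ox /=.
have -> : pder i (pders s (fun y => f y - g y)) x =
          pder i (fun y => pders s f y + (-1) * pders s g y) x.
  apply: near_eq_derive; apply: filterS (near_Omega Ox) => y Oy.
  by rewrite IH ?(ltnW sk) // mulN1r.
by rewrite C1_at_pder_axpy ?mulN1r //; apply: Ck_closure_C1; eassumption.
Qed.

(** [Ck_norm] is a [sup], which bounds its elements only once the set is known to be bounded. *)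
Lemma Ck_norm_ge k f g s x : Ck_closure k Omega f -> Ck_closure k Omega g ->
  (size s <= k)%N -> Omega x ->
  `|pders s f x - pders s g x| <= Ck_norm k Omega (fun y => f y - g y).
Proof.
move=> fk gk sk Ox; rewrite -(pders_sub fk gk sk Ox).
have bd h : Ck_closure k Omega h -> exists M : seq 'I_d -> R, forall s, (size s <= k)%N ->
    0 < M s /\ forall x, Omega x -> `|pders s h x| <= M s.
  move=> hk.
  have /choice[M HM] : forall s, exists M : R, (size s <= k)%N -> 0 < M /\
     forall x, Omega x -> `|pders s h x| <= M.
    move=> s'; have [s'k|s'k] := boolP (size s' <= k)%N; last by exists 0.
    by have [M M0 HM] := Ck_closure_bounded hk s'k; exists M.
  by exists M.
have [Mf HMf] := bd f fk; have [Mg HMg] := bd g gk.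
apply: ub_le_sup; last by exists s, x.
(* There are finitely many multi-indices of length at most k; adding up absolute values gives one
   bound for all of them. *)
pose S (M : seq 'I_d -> R) := \sum_(n < k.+1) \sum_(t : n.-tuple 'I_d) `|M t|.
have SM M s' : (size s' <= k)%N -> M s' <= S M.
  move=> s'k; apply: le_trans (ler_norm _) _; rewrite /S.
  rewrite (bigD1 (Ordinal (s'k : (size s' < k.+1)%N))) //= (bigD1 (in_tuple s')) //=.
  by rewrite -addrA lerDl addr_ge0 // ?sumr_ge0 // => i _; rewrite sumr_ge0.
exists (S Mf + S Mg) => r [s' [y [s'k Oy ->]]].
rewrite (pders_sub fk gk s'k Oy); apply: le_trans (ler_normB _ _) _.
apply: lerD; [have [_ H] := HMf s' s'k|have [_ H] := HMg s' s'k];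
  by apply: le_trans (H y Oy) _; exact: SM.
Qed.

Lemma closure_approx (h : 'rV[R]_d -> R) (x : 'rV[R]_d) (e : R) (V : set 'rV[R]_d) :
  {within closure Omega, continuous h} -> closure Omega x -> 0 < e -> nbhs x V ->
  exists y, [/\ Omega y, V y & `|h x - h y| <= e].
Proof.
move=> /subspace_continuousP ch cx e0 xV.
have hx := ch x cx.
have : \forall y \near within (closure Omega) (nbhs x), `|h x - h y| <= e.
  exact: (proj1 (@cvgrPdist_le _ _ _ _ _ _ _) hx e e0).
rewrite near_withinE => nx.
have [y [Oy [Vy hy]]] := cx _ (filterI xV nx).
by exists y; split => //; apply: hy; exact: subset_closure.
Qed.

Variable T : R.

Lemma C0t_Ck_near k (w : 'rV[R]_d -> R -> R) (t0 e : R) : C0t_Ck T k Omega w ->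
  0 <= t0 <= T -> 0 < e ->
  exists2 r : R, 0 < r & forall t, 0 <= t <= T -> `|t0 - t| < r ->
  forall s x, (size s <= k)%N -> Omega x ->
  `|pders s (w^~ t) x - pders s (w^~ t0) x| <= e.
Proof.
move=> wk t0T e0.
have t0T' : t0 \in `[0, T] by rewrite in_itv.
have [w0 /cvgrPdist_le /(_ e e0)] := wk t0 t0T'.
rewrite near_withinE => /nbhs_ballP[r /= r0 H]; exists r => // t tT tr s x sk Ox.
have tT' : t \in `[0, T] by rewrite in_itv.
have [wt _] := wk t tT'.
have := H t tr tT'; rewrite sub0r normrN => /(le_trans (ler_norm _)).
by apply: le_trans; exact: Ck_norm_ge.
Qed.

(** Joint continuity follows from convergence in t uniform over Omega and continuity in x at the
    fixed time t0. The filter is restricted to Omega and [0, T], where [w] is controlled. *)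
Lemma C0t_Ck_pders_cvg k (w : 'rV[R]_d -> R -> R) s (x0 : 'rV[R]_d) (t0 : R) :
  C0t_Ck T k Omega w -> (size s <= k)%N -> Omega x0 -> 0 <= t0 <= T ->
  pders s (w^~ z.2) z.1 @[z --> within [set z | Omega z.1 /\ 0 <= z.2 <= T] (nbhs (x0, t0))]
    --> pders s (w^~ t0) x0.
Proof.
move=> wk sk Ox0 t0T; apply/cvgrPdist_le => e e0.
have e20 : 0 < e / 2 by rewrite divr_gt0.
have [r r0 H] := C0t_Ck_near wk t0T e20.
have t0T' : t0 \in `[0, T] by rewrite in_itv.
have [w0 _] := wk t0 t0T'.
have cx : pders s (w^~ t0) y @[y --> x0] --> pders s (w^~ t0) x0.
  exact: (Ck_closure_continuous w0 sk Ox0).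
have nx := proj1 (@cvgrPdist_le _ _ _ (nbhs x0) (nbhs_filter x0) _ _) cx _ e20.
rewrite near_withinE.
have n1 : \forall z \near (x0, t0), `|pders s (w^~ t0) x0 - pders s (w^~ t0) z.1| <= e / 2.
  have := @cvg_fst _ _ (nbhs x0) (nbhs t0) _ _ nx. exact.
have n2 : \forall z \near (x0, t0), `|t0 - z.2| < r.
  have nr : \forall t \near t0, `|t0 - t| < r by exact: (@nbhsx_ballx _ _ t0 r).
  have := @cvg_snd _ _ (nbhs x0) (nbhs t0) _ _ nr. exact.
apply: filterS2 n1 n2 => -[y t] /= h1 h2 [Oy tT].
have := H t tT h2 s y sk Oy; rewrite distrC => h3.
have -> : pders s (w^~ t0) x0 - pders s (w^~ t) y = (pders s (w^~ t0) x0 - pders s (w^~ t0) y)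
  + (pders s (w^~ t0) y - pders s (w^~ t) y) by rewrite addrA subrK.
by apply: le_trans (ler_normD _ _) _; rewrite [leRHS](splitr e) lerD.
Qed.

Lemma C0t_Ck_closure_near k (w : 'rV[R]_d -> R -> R) (t0 e : R) : C0t_Ck T k Omega w ->
  0 <= t0 <= T -> 0 < e ->
  exists2 r : R, 0 < r & forall t, 0 <= t <= T -> `|t0 - t| < r ->
  forall x, closure Omega x -> `|w x t - w x t0| <= e.
Proof.
move=> wk t0T e0; have e20 : 0 < e / 2 by rewrite divr_gt0.
have [r r0 H] := C0t_Ck_near wk t0T e20; exists r => // t tT tr x cx.
have t0T' : t0 \in `[0, T] by rewrite in_itv.
have tT' : t \in `[0, T] by rewrite in_itv.
have [[w0 _] _] := wk t0 t0T'; have [[wt _] _] := wk t tT'.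
have ch : {within closure Omega, continuous (fun x => w x t - w x t0)}.
  by move=> y; apply: cvgB; [exact: wt|exact: w0].
have [y [Oy _ hy]] := closure_approx ch cx e20 (@filterT _ (nbhs x) _).
have := H t tT tr [::] y (leq0n _) Oy => /= h2.
rewrite -[w x t - w x t0](subrK (w y t - w y t0)).
by apply: le_trans (ler_normD _ _) _; rewrite [leRHS](splitr e) lerD.
Qed.

Lemma C0t_Ck_within_continuous k (w : 'rV[R]_d -> R -> R) : C0t_Ck T k Omega w ->
  {within closure Omega `*` `[0, T], continuous (fun z => w z.1 z.2)}.
Proof.
move=> wk; apply/subspace_continuousP => -[x0 t0] /= [cx0]; rewrite in_itv /= => t0T.
apply/cvgrPdist_le => e e0; have e20 : 0 < e / 2 by rewrite divr_gt0.
have [r r0 H] := C0t_Ck_closure_near wk t0T e20.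
have t0T' : t0 \in `[0, T] by rewrite in_itv.
have [[/subspace_continuousP w0 _] _] := wk t0 t0T'.
have nx : \forall y \near within (closure Omega) (nbhs x0), `|w x0 t0 - w y t0| <= e / 2.
  exact: (proj1 (@cvgrPdist_le _ _ _ _ _ _ _) (w0 x0 cx0) _ e20).
rewrite near_withinE in nx; rewrite near_withinE.
have n1 : \forall z \near (x0, t0), closure Omega z.1 -> `|w x0 t0 - w z.1 t0| <= e / 2.
  exact: (@cvg_fst _ _ (nbhs x0) (nbhs t0) _ _ nx).
have n2 : \forall z \near (x0, t0), `|t0 - z.2| < r.
  have nr : \forall t \near t0, `|t0 - t| < r by exact: (@nbhsx_ballx _ _ t0 r).
  have := @cvg_snd _ _ (nbhs x0) (nbhs t0) _ _ nr. exact.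
apply: filterS2 n1 n2 => -[y t] /= h1 h2 [cy tT]; rewrite in_itv /= in tT.
have := H t tT h2 y cy; rewrite distrC => h3.
have -> : w x0 t0 - w y t = (w x0 t0 - w y t0) + (w y t0 - w y t) by rewrite addrA subrK.
by apply: le_trans (ler_normD _ _) _; rewrite [leRHS](splitr e) lerD ?h1.
Qed.

End Ck_spaces.

(** * The elliptic operator at a minimum *)

Lemma cvg_fsum (R : realType) (S : Type) (F : set_system S) {FF : Filter F}
  (I : finType) (f : I -> S -> R) (l : I -> R) :
  (forall i, f i @ F --> l i) -> (fun x => \sum_i f i x) @ F --> \sum_i l i.
Proof.
move=> fl; apply: (@cvg_big _ _ +%R 0 xpredT _ _ F _ f l) => //.
exact: add_continuous.
Qed.

Section elliptic_part.
Context (R : realType) (d : nat).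
Variable Omega : set 'rV[R]_d.
Hypothesis oOmega : open Omega.
Hypothesis cOmega : compact (closure Omega).
Variable T : R.
Variables (aij : 'I_d -> 'I_d -> 'rV[R]_d -> R) (b : 'I_d -> 'rV[R]_d -> R -> R)
  (b0 : 'rV[R]_d -> R -> R).
Hypothesis haC1 : forall i j, Ck_closure 1 Omega (aij i j).
Hypothesis hasym : forall i j x, closure Omega x -> aij i j x = aij j i x.
Hypothesis haell : uniformly_elliptic Omega aij.
Hypothesis hb : forall j, C0t_Ck T 2 Omega (b j).
Hypothesis hb0 : C0t_Ck T 2 Omega b0.

(** [- A1] in nondivergence form without its zeroth-order term. It acts on functions of x alone, so
    it also applies to the perturbation; t enters through the b_j. *)
Definition second_order (f : 'rV[R]_d -> R) (x : 'rV[R]_d) (t : R) : R :=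
  \sum_i \sum_j (pder i (aij i j) x * pder j f x + aij i j x * pder i (pder j f) x)
  + \sum_j b j x t * pder j f x.

Lemma A1E (u : 'rV[R]_d -> R -> R) x t : Ck_closure 2 Omega (u^~ t) -> Omega x ->
  A1 aij b b0 u x t = b0 x t * u x t - second_order (u^~ t) x t.
Proof.
move=> u2 Ox; rewrite /A1 /second_order opprB; congr (_ - (_ + _)).
apply: eq_bigr => i _; apply: eq_bigr => j _.
have [/nbhs_singleton da _] := Ck_closure_C1 (s := [::]) oOmega (haC1 i j) isT Ox.
have [/nbhs_singleton du _] := Ck_closure_C1 (s := [:: j]) oOmega u2 isT Ox.
have := deriveM (da i) (du i); rewrite /pder => ->.
by rewrite addrC mulrC.
Qed.

Lemma second_order_axpy f g (c : R) x t : C2_at f x -> C2_at g x ->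
  second_order (fun y => f y + c * g y) x t = second_order f x t + c * second_order g x t.
Proof.
move=> f2 g2; have [_ E2] := C2_at_axpy c f2 g2.
have E1 j := C1_at_pder_axpy c j (C2_at_C1 f2) (C2_at_C1 g2).
rewrite /second_order mulrDr addrACA; congr (_ + _).
  rewrite mulr_sumr -big_split; apply: eq_bigr => i _ /=.
  rewrite mulr_sumr -big_split; apply: eq_bigr => j _ /=.
  by rewrite E1 E2 !mulrDr addrACA; congr (_ + (_ + _)); rewrite mulrCA.
rewrite mulr_sumr -big_split; apply: eq_bigr => j _ /=.
by rewrite E1 mulrDr; congr (_ + _); rewrite mulrCA.
Qed.

(** Ellipticity is given in Omega; continuity of the a_ij carries it to the closure, and on the
    boundary it makes the conormal direction transversal. *)
Lemma elliptic_posdef x (xi : 'I_d -> R) : closure Omega x -> (exists i, xi i != 0) ->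
  0 < \sum_i \sum_j aij i j x * xi i * xi j.
Proof.
move=> cx [i0 xi0]; have [kappa k0 H] := haell.
have s0 : 0 < \sum_j xi j ^+ 2.
  rewrite (bigD1 i0) //= ltr_wpDr ?sumr_ge0 // => [j _|]; first exact: sqr_ge0.
  by rewrite lt0r sqrf_eq0 xi0 sqr_ge0.
apply: (@lt_le_trans _ _ (kappa * \sum_j xi j ^+ 2)); first exact: mulr_gt0.
pose h x := \sum_i \sum_j aij i j x * xi i * xi j.
have ch : {within closure Omega, continuous h}.
  move=> y; apply: cvg_fsum => i; apply: cvg_fsum => j.
  apply: cvgMr_tmp; apply: cvgMr_tmp.
  by have [ca _] := haC1 i j; exact: ca.
rewrite -/(h x) leNgt; apply/negP => hx.
pose e := (kappa * \sum_j xi j ^+ 2 - h x) / 2.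
have e0 : 0 < e by rewrite divr_gt0 // subr_gt0.
have [y [Oy _]] := closure_approx ch cx e0 (@filterT _ (nbhs x) _).
have := H y Oy xi; rewrite -/(h y) ler_norml => h1 /andP[h2 _].
rewrite /e in e0 h2; lra.
Qed.

Lemma elliptic_at_min (u g : 'rV[R]_d -> R) (c : R) x t : Omega x ->
  C2_at u x -> C2_at g x ->
  (\forall y \near x, u x + c * g x <= u y + c * g y) ->
  0 <= second_order u x t + c * second_order g x t.
Proof.
move=> Ox u2 g2 minx; rewrite -second_order_axpy //.
have [v2 _] := C2_at_axpy c u2 g2; set v := (fun y => _) in v2 *.
have g0 := local_min_grad v2 minx; have H0 := local_min_hessian v2 minx.
rewrite /second_order [X in _ + X]big1 ?addr0; last by move=> j _; rewrite g0 mulr0.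
have -> : \sum_i \sum_j (pder i (aij i j) x * pder j v x + aij i j x * pder i (pder j v) x)
   = \sum_i \sum_j aij i j x * pder i (pder j v) x.
  by apply: eq_bigr => i _; apply: eq_bigr => j _; rewrite g0 mulr0 add0r.
have cx : closure Omega x by exact: subset_closure.
apply: posdef_trace_ge0.
- by move=> i j; exact: hasym.
- by move=> xi; exact: elliptic_posdef.
- move=> q; have := H0 (\row_i q i).
  by under eq_bigr do under eq_bigr do rewrite !mxE.
Qed.

Lemma A1_le_at_min (u : 'rV[R]_d -> R -> R) (g : 'rV[R]_d -> R) (c : R) x t :
  Ck_closure 2 Omega (u^~ t) -> Omega x -> C2_at g x ->
  (\forall y \near x, u x t + c * g x <= u y t + c * g y) ->
  A1 aij b b0 u x t <= b0 x t * u x t + c * second_order g x t.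
Proof.
move=> u2 Ox g2 minx; rewrite A1E //.
have := elliptic_at_min t Ox (Ck_closure_C2 oOmega u2 Ox) g2 minx; lra.
Qed.

Lemma A1_cvg (u : 'rV[R]_d -> R -> R) x0 t0 : C0t_Ck T 2 Omega u ->
  Omega x0 -> 0 <= t0 <= T ->
  A1 aij b b0 u z.1 z.2
    @[z --> within [set z | Omega z.1 /\ 0 <= z.2 <= T] (nbhs (x0, t0))]
    --> A1 aij b b0 u x0 t0.
Proof.
move=> hu Ox0 t0T; set F := within _ _.
have FF : Filter F by exact: within_filter.
have inT t : 0 <= t <= T -> t \in `[0, T] by rewrite in_itv.
have uE x t : Omega x -> 0 <= t <= T -> A1 aij b b0 u x t = b0 x t * u x t - second_order (u^~ t) x t.
  by move=> Ox tT; rewrite A1E //; have [] := hu t (inT t tT).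
rewrite uE //.
have cw (w : 'rV[R]_d -> R -> R) s : C0t_Ck T 2 Omega w -> (size s <= 2)%N ->
    pders s (w^~ z.2) z.1 @[z --> F] --> pders s (w^~ t0) x0.
  by move=> hw s2; exact: (C0t_Ck_pders_cvg oOmega cOmega hw).
have ca i j s : (size s <= 1)%N -> pders s (aij i j) z.1 @[z --> F] --> pders s (aij i j) x0.
  move=> s1; have cx := Ck_closure_continuous oOmega (haC1 i j) s1 Ox0.
  have cF : fst @ F --> nbhs x0.
    by apply: cvg_trans (@cvg_fst _ _ (nbhs x0) (nbhs t0) _); apply: cvg_app; exact: cvg_within.
  exact: (cvg_comp _ _ cF cx).
have cA : b0 z.1 z.2 * u z.1 z.2 - second_order (u^~ z.2) z.1 z.2 @[z --> F] -->
   b0 x0 t0 * u x0 t0 - second_order (u^~ t0) x0 t0.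
  apply: cvgB.
    by apply: cvgM; [exact: (cw b0 [::])|exact: (cw u [::])].
  apply: cvgD; last first.
    apply: cvg_fsum => j; apply: cvgM; [exact: (cw (b j) [::])|exact: (cw u [:: j])].
  apply: cvg_fsum => i; apply: cvg_fsum => j; apply: cvgD.
    by apply: cvgM; [exact: (ca i j [:: i])|exact: (cw u [:: j])].
  by apply: cvgM; [exact: (ca i j [::])|exact: (cw u [:: i; j])].
apply: cvg_trans cA; apply: near_eq_cvg; rewrite near_withinE.
by apply: (@filterE _ (nbhs (x0, t0)) _) => z [Oz zT]; rewrite uE.
Qed.

End elliptic_part.

(** * The fractional derivative at a minimum *)

Lemma small_powR (R : realType) (p K e m : R) : 0 < p -> 0 < e -> 0 < m ->
  exists2 x : R, 0 < x < m & K * x `^ p < e.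
Proof.
move=> p0 e0 m0.
have H : K * x `^ p @[x --> (0 : R)^'+] --> K * 0.
  by apply: cvgMl_tmp; exact: powR_cvg0.
rewrite mulr0 in H.
have : \forall x \near (0 : R)^'+, K * x `^ p < e by exact: (cvgr_lt _ H).
move=> H'.
near ((0 : R)^'+) => x; exists x; last by near: x.
by apply/andP; split; near: x; [exact: nbhs_right_gt|exact: nbhs_right_lt].
Unshelve. all: by end_near. Qed.

Section time_part.
Context (R : realType) (d : nat).
Local Notation mu := (@lebesgue_measure R).
Variable Omega : set 'rV[R]_d.
Hypothesis oOmega : open Omega.
Hypothesis cOmega : compact (closure Omega).
Variables (T : R) (T0 : 0 < T).
Variables (aij : 'I_d -> 'I_d -> 'rV[R]_d -> R) (b : 'I_d -> 'rV[R]_d -> R -> R)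
  (b0 : 'rV[R]_d -> R -> R).
Hypothesis haC1 : forall i j, Ck_closure 1 Omega (aij i j).
Hypothesis hb : forall j, C0t_Ck T 2 Omega (b j).
Hypothesis hb0 : C0t_Ck T 2 Omega b0.
Variables (alpha : R) (alpha01 : 0 < alpha < 1).
Variables (u : 'rV[R]_d -> R -> R) (hu : C0t_Ck T 2 Omega u).
Variable a : 'rV[R]_d -> R.

(** What remains at one point x of the equation and of the signs of F and a. It holds for almost
    every x of Omega, hence on a dense subset. *)
Definition supersolution_at (x : 'rV[R]_d) := 0 <= a x /\ exists w : R -> R,
  [/\ L2 mu `]0, T[ w,
      {ae mu, forall t, t \in `]0, T[ -> frac_integral alpha w t = u x t - a x} &
      {ae mu, forall t, 0 < t < T -> 0 <= w t + A1 aij b b0 u x t}].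

Lemma time_continuous x : closure Omega x -> {within `[0, T], continuous (u x)}.
Proof.
move=> cx; apply/subspace_continuousP => t0; rewrite /= in_itv /= => t0T.
apply/cvgrPdist_le => e e0.
have [r r0 H] := C0t_Ck_closure_near oOmega cOmega hu t0T e0.
rewrite near_withinE; apply/nbhs_ballP; exists r => //= t tr; rewrite in_itv /= => tT.
by rewrite distrC; exact: H.
Qed.

Lemma time_bounded x : closure Omega x ->
  exists M : R, forall t, 0 <= t <= T -> `|u x t - a x| <= M.
Proof.
move=> cx; have := compact_continuous_bounded (@segment_compact _ 0 T) (time_continuous cx).
move=> [M _ H]; exists (M + `|a x|) => t tT; apply: le_trans (ler_normB _ _) _.
by rewrite lerD2r; apply: H; rewrite /= in_itv.
Qed.

Lemma time_measurable x : closure Omega x ->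
  measurable_fun `]0, T[ (fun t => u x t - a x).
Proof.
move=> cx; apply: measurable_funB => //.
apply: subspace_continuous_measurable_fun; first exact: measurable_itv.
apply: continuous_subspaceW (time_continuous cx).
by move=> t; rewrite /= !in_itv /= => /andP[/ltW -> /ltW ->].
Qed.

(** Hence a strict sign of [A1 u] at (x0, t0) is inherited by nearby points, among which the
    equation is available. *)
Lemma A1_near x0 t0 e : Omega x0 -> 0 <= t0 <= T -> 0 < e ->
  exists2 r : R, 0 < r & forall x t, ball x0 r x -> Omega x -> 0 <= t <= T ->
    `|t0 - t| < r -> `|A1 aij b b0 u x0 t0 - A1 aij b b0 u x t| <= e.
Proof.
move=> Ox0 t0T e0.
have /cvgrPdist_le /(_ e e0) := A1_cvg oOmega cOmega haC1 hb hb0 hu Ox0 t0T.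
rewrite near_withinE => -[[P Q] /= [nP nQ] H].
move: nP nQ => /nbhs_ballP[r1 /= r10 H1] /nbhs_ballP[r2 /= r20 H2].
exists (Num.min r1 r2); first by rewrite lt_min r10.
move=> x t bx Ox tT; rewrite lt_min => /andP[_ tr].
apply: (H (x, t)) => //; split => /=.
  by apply: H1; apply: le_ball bx; rewrite ge_min lexx.
exact: H2.
Qed.

Lemma initial_value_ge0 x : Omega x -> supersolution_at x -> 0 <= u x 0.
Proof.
move=> Ox [ax0 [w [w2 wE wA]]]; have cx : closure Omega x by exact: subset_closure.
rewrite leNgt; apply/negP => ux0; have /andP[al0 al1] := alpha01.
have zT : 0 <= (0 : R) <= T by rewrite lexx ltW.
pose kappa := - u x 0 / 2; have k0 : 0 < kappa by rewrite divr_gt0 // oppr_gt0.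
have [r1 r10 H1] := A1_near Ox zT ltr01.
have [r2 r20 H2] := C0t_Ck_closure_near oOmega cOmega hu zT k0.
pose C := A1 aij b b0 u x 0 + 1.
have [M HM] := time_bounded cx.
have p0 : 0 < 1 - alpha by lra.
have m0 : 0 < Num.min T (Num.min r1 r2) by rewrite !lt_min T0 r10.
have kp0 : 0 < kappa / (1 - alpha) by rewrite divr_gt0.
(* After division by tau^(1 - alpha), the inequality of [fractional_initial] bounds kappa / (1 -
   alpha) by a multiple of tau^alpha; tau is chosen to violate this. *)
have [tau /andP[tau0]] := small_powR (abel_const alpha * C) al0 kp0 m0.
rewrite !lt_min => /and3P[tauT taur1 taur2] small.
have tT t : 0 < t < tau -> 0 <= t <= T.
  by move=> /andP[/ltW -> tt]; rewrite (ltW (lt_trans tt tauT)).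
have : kappa * (tau `^ (1 - alpha) / (1 - alpha)) <= abel_const alpha * C * tau.
  apply: (@fractional_initial R alpha T _ w alpha01 w2 wE (time_measurable cx) tau kappa C M).
  - by rewrite tau0 ltW.
  - by move=> t tt; exact: HM (tT t tt).
  - move=> t tt; have := H2 t (tT t tt); have /andP[t0 ttau] := tt.
    rewrite sub0r normrN gtr0_norm // (lt_trans ttau taur2) => /(_ isT x cx).
    rewrite ler_distl => /andP[_ h]; apply: le_trans (_ : u x t <= _); first by rewrite gerBl.
    by apply: le_trans h _; rewrite /kappa; lra.
  - have FF := ae_filter_ringOfSetsType (mu : {measure set (measurableTypeR R) -> \bar R}).
    apply: (@filterS _ _ FF _ _ _ wA) => t Ht tt; have /andP[t0 ttau] := tt.
    have := Ht; rewrite t0 (lt_trans ttau tauT) => /(_ isT) wt.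
    have := H1 x t (ballxx _ r10) Ox (tT t tt).
    rewrite sub0r normrN gtr0_norm // (lt_trans ttau taur1) => /(_ isT).
    rewrite distrC ler_distl -/C => /andP[_ h].
    by rewrite -subr_ge0 opprK; apply: le_trans wt _; rewrite lerD2l.
have tauE : tau `^ (1 - alpha) * tau `^ alpha = tau.
  by rewrite -powRD ?subrK ?powRr1 ?(ltW tau0) // gt_eqF ?implybT.
have tp : 0 < tau `^ (1 - alpha) by exact: powR_gt0.
rewrite -{2}tauE (mulrCA kappa) (mulrCA (abel_const alpha * C)) ler_pM2l // => h.
by have := le_lt_trans h small; rewrite ltxx.
Qed.

Lemma derivable_locally_lipschitz (f : R -> R) t0 : derivable f t0 1 ->
  exists L, exists r, [/\ 0 <= L, 0 < r & forall t, `|t0 - t| < r ->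
    `|f t - f t0| <= L * `|t - t0| ].
Proof.
move=> df; pose L := `|'D_1 f t0| + 1; exists L.
have cv : h^-1 *: (f (h *: 1 + t0) - f t0) @[h --> (0 : R)^'] --> 'D_1 f t0 by exact: df.
have /cvgrPdist_le /(_ 1 ltr01) /nbhs_ballP[r /= r0 H] := cv.
exists r; split => //; first by rewrite addr_ge0.
move=> t tr; have [->|tt0] := eqVneq t t0; first by rewrite !subrr normr0 mulr0.
have h0 : t - t0 != 0 by rewrite subr_eq0.
have := H (t - t0); rewrite /ball /= sub0r opprB => /(_ tr h0).
rewrite [_ *: 1]mulr1 subrK => Hq.
have Q : `|(t - t0)^-1 * (f t - f t0)| <= L.
  rewrite /L -[X in `|X|](subrK ('D_1 f t0)) addrC.
  by apply: le_trans (ler_normD _ _) _; rewrite lerD2l distrC.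
have -> : f t - f t0 = ((t - t0)^-1 * (f t - f t0)) * (t - t0) by rewrite mulrAC mulVf // mul1r.
by rewrite normrM ler_wpM2r.
Qed.

(** The spatial gradient is jointly continuous, so one Lipschitz constant in x serves all times near
    t0. It transfers the estimate in time from x0, where it is known, to nearby x. *)
Lemma space_lipschitz x0 t0 : Omega x0 -> 0 <= t0 <= T -> exists B, exists r,
  [/\ 0 <= B, 0 < r, ball x0 r `<=` Omega & forall x t, ball x0 r x -> 0 <= t <= T ->
    `|t0 - t| < r -> `|u x t - u x0 t| <= B * \sum_i `|x ord0 i - x0 ord0 i| ].
Proof.
move=> Ox0 t0T; pose B := \sum_i (`|pder i (u^~ t0) x0| + 1).
have B0 : 0 <= B by apply: sumr_ge0 => i _; rewrite addr_ge0.
have nb : \forall z \near (x0, t0), forall i, Omega z.1 /\ 0 <= z.2 <= T ->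
    `|pder i (u^~ t0) x0 - pder i (u^~ z.2) z.1| <= 1.
  apply: (@filter_forall _ _ (fun i z => Omega z.1 /\ 0 <= z.2 <= T ->
    `|pder i (u^~ t0) x0 - pder i (u^~ z.2) z.1| <= 1) (nbhs (x0, t0))) => i.
  have /cvgrPdist_le /(_ 1 ltr01) :=
    C0t_Ck_pders_cvg (s := [:: i]) oOmega cOmega hu isT Ox0 t0T.
  by rewrite near_withinE.
have /nbhs_ballP[r0 /= r00 H0] := near_Omega oOmega Ox0.
move: nb => [[P Q] /= [/nbhs_ballP[r1 /= r10 H1] /nbhs_ballP[r2 /= r20 H2]] H].
exists B, (Num.min r0 (Num.min r1 r2)); split => //.
- by rewrite !lt_min r00 r10.
- by move=> y yb; apply: H0; apply: le_ball yb; rewrite ge_min lexx.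
move=> x t bx tT; rewrite !lt_min => /and3P[_ _ tr2].
have r0' : 0 < Num.min r0 (Num.min r1 r2) by rewrite !lt_min r00 r10.
have tT' : t \in `[0, T] by rewrite in_itv.
have [ut _] := hu tT'.
have := @C1_increment R d (u^~ t) x0 (Num.min r0 (Num.min r1 r2)) (fun=> 0) B.
move=> Hinc; have := Hinc _ x0 x (ballxx _ r0') bx.
rewrite big1 ?subr0; last by move=> i _; rewrite mul0r.
apply => i y yb; have Oy : Omega y by apply: H0; apply: le_ball yb; rewrite ge_min lexx.
split.
  have [/nbhs_singleton dd _] := Ck_closure_C1 (s := [::]) oOmega ut isT Oy.
  exact: dd.
have yP : P y by apply: H1; apply: le_ball yb; rewrite !ge_min lexx orbT.
have tQ : Q t by exact: H2.
have := H (y, t) (conj yP tQ) i (conj Oy tT) => /= h.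
rewrite subr0 -[pder i _ y](subrK (pder i (u^~ t0) x0)) addrC.
apply: le_trans (ler_normD _ _) _; rewrite (distrC _ (pder i (u^~ t0) x0)).
apply: (@le_trans _ _ (`|pder i (u^~ t0) x0| + 1)); first by rewrite lerD2l.
by rewrite /B (bigD1 i) //= lerDl sumr_ge0 // => j _; rewrite addr_ge0.
Qed.

(* The time profile at [x0] has its minimum over [[0, t0]] at [t0] up to the
   perturbation [g]; nearby supersolution points [x] carry the contradiction. *)
Lemma no_negative_minimum (x0 : 'rV[R]_d) (t0 : R) (g : 'rV[R]_d -> R) :
  (forall (x : 'rV[R]_d) (V : set 'rV[R]_d), Omega x -> nbhs x V ->
    exists2 y, V y & Omega y /\ supersolution_at y) ->
  Omega x0 -> 0 < t0 < T -> derivable (u x0) t0 1 -> {for x0, continuous g} ->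
  (\forall x \near x0, forall t, 0 <= t <= t0 -> u x0 t0 + g x0 <= u x t + g x) ->
  u x0 t0 < 0 -> 0 <= A1 aij b b0 u x0 t0.
Proof.
move=> good Ox0 /andP[t00 t0T] du cg minv u0; rewrite leNgt; apply/negP => A0.
have /andP[al0 al1] := alpha01.
have p0 : 0 < 1 - alpha by rewrite subr_gt0.
have t0T' : 0 <= t0 <= T by rewrite !ltW.
pose kappa := - u x0 t0 / 2; have k0 : 0 < kappa by rewrite divr_gt0 // oppr_gt0.
have [r1 r10 H1] : exists2 r : R, 0 < r & forall x t, ball x0 r x -> Omega x ->
    0 <= t <= T -> `|t0 - t| < r -> A1 aij b b0 u x t <= 0.
  have e0 : 0 < - A1 aij b b0 u x0 t0 / 2 by rewrite divr_gt0 // oppr_gt0.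
  have [r r0 H] := A1_near Ox0 t0T' e0.
  exists r => // x t bx Ox tT tr; have := H x t bx Ox tT tr.
  rewrite distrC ler_distl => /andP[_ /le_trans]; apply.
  by rewrite mulNr subr_le0 ler_pdivlMr // mulr_natr mulr2n gerDl ltW.
clear A0.
have [L [r2 [L0 r20 H2]]] := derivable_locally_lipschitz du.
have [B [r4 [B0 r40 r4O H4]]] := space_lipschitz Ox0 t0T'.
(* Of the two extra units of eta, one pays for replacing x0 by x in u and one for the variation of g
   between x0 and x. *)
pose L' := L + 2.
have L'0 : 0 <= L' by rewrite addr_ge0.
have m0 : 0 < Num.min t0 (Num.min r1 (Num.min r2 r4)) by rewrite !lt_min t00 r10 r20.
have kt0 : 0 < kappa * t0 `^ (- alpha) by rewrite mulr_gt0 // powR_gt0.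
have [eta /andP[eta0]] := small_powR (L' / (1 - alpha)) p0 kt0 m0.
rewrite !lt_min => /and4P[etat0 eta1 eta2 eta4] small.
have tT t : t0 - eta <= t < t0 -> [/\ 0 < t, t < T, `|t0 - t| <= eta & 0 <= t <= T].
  move=> /andP[t1 t2]; have tp : 0 < t by lra.
  have tlT := lt_trans t2 t0T; split => //; last by rewrite (ltW tp) ltW.
  by rewrite ger0_norm ?subr_ge0 ?(ltW t2) // lerBlDr addrC -lerBlDr.
(* Within r3 of x0 the spatial variation of u is at most B * d * r3 <= eta. *)
pose D := B * d%:R + 1; have D0 : 0 < D by rewrite ltr_wpDl // mulr_ge0.
pose r3 := Num.min r4 (eta / D).
have r30 : 0 < r3 by rewrite lt_min r40 divr_gt0.
have H3 x : ball x0 r3 x -> forall t, t0 - eta <= t < t0 -> u x t <= u x0 t + eta.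
  move=> bx t /tT[_ _ teta tT']; have bx4 : ball x0 r4 x.
    by apply: le_ball bx; rewrite ge_min lexx.
  have := H4 x t bx4 tT' (le_lt_trans teta eta4); rewrite ler_distl => /andP[_].
  move=> /le_trans; apply; rewrite lerD2l.
  apply: (@le_trans _ _ (B * \sum_(i < d) r3)).
    rewrite ler_wpM2l // ler_sum // => i _; move/rV_ballP: bx => [_ /(_ i)].
    by rewrite distrC => /ltW.
  rewrite sumr_const card_ord -[r3 *+ d]mulr_natr [r3 * _]mulrC mulrA.
  apply: (@le_trans _ _ (D * r3)); first by rewrite ler_wpM2r ?(ltW r30) // lerDl.
  by rewrite mulrC -ler_pdivlMr // ge_min lexx orbT.
have cg' : g y @[y --> x0] --> g x0 by exact: cg.
have gx := proj1 (@cvgrPdist_le _ _ _ (nbhs x0) (nbhs_filter x0) _ _) cg'.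
have gk := gx kappa k0; have geta := gx eta eta0.
have FFx : Filter (nbhs x0) by exact: nbhs_filter.
have nI := @filterI _ (nbhs x0) FFx.
have nV := nI _ _ (nI _ _ minv (nI _ _ gk geta))
  (nI _ _ (nbhsx_ballx x0 _ r10) (nbhsx_ballx x0 _ r30)).
have [x [[minx [gkx getax]] [b1 b3]] [Ox [ax0 [w [w2 wE wA]]]]] := good x0 _ Ox0 nV.
have cx : closure Omega x by exact: subset_closure.
have [M HM] := time_bounded cx.
have : kappa * t0 `^ (- alpha) <= L' * (eta `^ (1 - alpha) / (1 - alpha)).
  apply: (@fractional_extremum R alpha T _ w alpha01 w2 wE (time_measurable cx) t0 eta kappa L' M).
  - by rewrite eta0.
  - exact: ltW.
  - by move=> t /andP[t1 t2]; apply: HM; rewrite (ltW t1) (ltW (lt_trans t2 t0T)).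
  - exists (u x0 t0 + g x0 - g x - a x).
      move: gkx => /=; rewrite ler_norml => /andP[_]; rewrite /kappa; lra.
    split.
      move=> t /andP[t1 t2]; have := minx t; rewrite (ltW t1) (ltW t2) => /(_ isT).
      lra.
    move=> t tt; have h3 := H3 x b3 t tt; have [_ _ teta _] := tT t tt.
    have := H2 t (le_lt_trans teta eta2); rewrite ler_distl => /andP[_ h2].
    have h4 : L * `|t - t0| <= L * eta by rewrite ler_wpM2l // distrC.
    move: getax => /=; rewrite ler_norml => /andP[h5 _].
    rewrite /L'; nra.
  - exact: L'0.
  - have FF := ae_filter_ringOfSetsType (mu : {measure set (measurableTypeR R) -> \bar R}).
    apply: (@filterS _ _ FF _ _ _ wA) => t Ht /andP[t1 t2].
    have [|tp tlT teta tT'] := tT t; first by rewrite (ltW t1).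
    have := H1 x t b1 Ox tT' (le_lt_trans teta eta1) => h1.
    have := Ht; rewrite tp tlT => /(_ isT) /le_trans; apply.
    by rewrite gerDl.
rewrite (_ : L' * _ = L' / (1 - alpha) * eta `^ (1 - alpha)); last by rewrite mulrCA mulrC.
by rewrite leNgt small.
Qed.

End time_part.

(** * The boundary condition at a minimum *)

Section conormal.
Context (R : realType) (d : nat).
Variable Omega : set 'rV[R]_d.
Hypothesis oOmega : open Omega.
Hypothesis cOmega : compact (closure Omega).
Variable aij : 'I_d -> 'I_d -> 'rV[R]_d -> R.
Hypothesis haC1 : forall i j, Ck_closure 1 Omega (aij i j).
Hypothesis haell : uniformly_elliptic Omega aij.

(** The [lim] in [pder_closure] is a true limit: the derivative extends continuously, and the filter
    is proper because x lies in the closure. *)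
Lemma pder_closure_cvg j (f : 'rV[R]_d -> R) x : Ck_closure 1 Omega f -> closure Omega x ->
  pder j f y @[y --> within Omega (nbhs x)] --> pder_closure Omega j f x.
Proof.
move=> [_ H] cx; have [_ [g /subspace_continuousP cg gE]] := H [:: j] isT.
have PF : ProperFilter (within Omega (nbhs x)).
  apply: (@Build_ProperFilter_ex _ _ _ (within_filter Omega (nbhs_filter x))).
  by move=> P /cx[y [Oy Py]]; exists y; exact: Py.
have fg : pder j f y @[y --> within Omega (nbhs x)] --> g x.
  have gx : g y @[y --> within Omega (nbhs x)] --> g x.
    apply: cvg_trans (cg x cx) => P; rewrite /= !nbhs_simpl /within /=.
    by apply: filterS => y Hy Oy; apply: Hy; exact: subset_closure.
  apply: cvg_trans gx; apply: near_eq_cvg; rewrite near_withinE.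
  by apply: (@filterE _ (nbhs x) _) => y Oy; rewrite gE.
by rewrite /pder_closure (cvg_lim _ fg).
Qed.

Lemma line_within_continuous (u : 'rV[R]_d -> R) x v (s : R) :
  {within closure Omega, continuous u} ->
  (forall t, 0 <= t <= s -> closure Omega (x + t *: v)) ->
  {within `[0, s], continuous (fun t => u (x + t *: v))}.
Proof.
move=> /subspace_continuousP cu Hp; apply/subspace_continuousP => t.
rewrite /= in_itv /= => ts; apply/cvgrPdist_le => e e0.
have nu : \forall y \near (x + t *: v), closure Omega y -> `|u (x + t *: v) - u y| <= e.
  have := proj1 (@cvgrPdist_le _ _ _ _ _ _ _) (cu _ (Hp t ts)) e e0.
  by move=> h; rewrite near_withinE in h; exact: h.
have cp : x + r *: v @[r --> t] --> x + t *: v.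
  by apply: cvgD; [apply: cvg_cst|apply: cvgZr_tmp].
have nt : \forall r \near t, closure Omega (x + r *: v) ->
    `|u (x + t *: v) - u (x + r *: v)| <= e by exact: (cp _ nu).
rewrite near_withinE.
by apply: filterS nt => r Hr; rewrite /= in_itv /= => rs; apply: Hr; exact: Hp.
Qed.

(** Outside Omega phi is nonnegative; a positive value would persist nearby and keep Omega away from
    x1. *)
Lemma defining_function_boundary (x1 : 'rV[R]_d) (U : set 'rV[R]_d) (phi : 'rV[R]_d -> R) :
  closure Omega x1 -> ~ Omega x1 -> defining_function Omega x1 U phi -> phi x1 = 0.
Proof.
move=> cx1 nOx1 [oU Ux1 sphi gphi Uphi].
apply/eqP; rewrite eq_le; apply/andP; split; last first.
  by rewrite leNgt; apply/negP => /(Uphi x1 Ux1).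
rewrite leNgt; apply/negP => p0.
have [cphi _] := sphi [::] x1 Ux1.
have cphi' : phi y @[y --> x1] --> phi x1 by exact: cphi.
have np := proj1 (@cvgrPdist_lt _ _ _ (nbhs x1) (nbhs_filter x1) _ _) cphi' _ p0.
have nU : nbhs x1 U by exact: open_nbhs_nbhs.
have [y [Oy [Uy hy]]] := cx1 _ (@filterI _ (nbhs x1) (nbhs_filter x1) _ _ nU np).
have := (Uphi y Uy).1 Oy; move: hy; rewrite /= ltr_distlC => /andP[h _].
by rewrite ltNge ltW //; apply: le_lt_trans h; rewrite subrr.
Qed.

(** Let n be the gradient of phi and q = A n, so that the conormal derivative is a positive multiple
    of q . D. Going along v = - q, phi decreases since q . n > 0, so the path enters Omega; there w
    + eps psi has slope close to - q . D - eps q . n < 0, against minimality at x1. *)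
Lemma boundary_no_min (x1 : 'rV[R]_d) (U : set 'rV[R]_d) (phi psi w : 'rV[R]_d -> R)
   (nu : 'rV[R]_d -> 'rV[R]_d) (eps : R) :
  closure Omega x1 -> ~ Omega x1 -> defining_function Omega x1 U phi ->
  nu x1 = (euclid_norm (grad phi x1))^-1 *: grad phi x1 ->
  Ck_closure 2 Omega w -> 0 <= conormal_derive Omega nu aij w x1 ->
  (\forall y \near x1, C1_at psi y) -> (forall i, pder i psi x1 = pder i phi x1) -> 0 < eps ->
  (\forall y \near x1, closure Omega y -> w x1 + eps * psi x1 <= w y + eps * psi y) -> False.
Proof.
move=> cx1 nOx1 dphi nuE w2 con psi1 dpsi eps0 minw.
have [oU Ux1 sphi gphi Uphi] := dphi.
have w1 : Ck_closure 1 Omega w.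
  have [h1 h2] := w2; split => // s s1; have [h3 h4] := h2 s (leq_trans s1 (leqnSn _)).
  by split => // s1'; apply: h3; exact: leq_trans s1' _.
pose n i := pder i phi x1; pose q j := \sum_i aij i j x1 * n i.
pose D j := pder_closure Omega j w x1.
have n0 : exists i, n i != 0.
  apply: contrapT => H; have /eqP := gphi x1 Ux1; apply; apply/rowP => i; rewrite !mxE.
  by apply: contrapT => ni; apply: H; exists i; apply/eqP.
have nq : 0 < \sum_j q j * n j.
  have := elliptic_posdef haC1 haell cx1 n0.
  rewrite exchange_big /=; congr (0 < _); apply: eq_bigr => j _.
  rewrite /q mulr_suml; apply: eq_bigr => i _; ring.
have S0 : 0 <= \sum_j q j * D j.
  have e0 : 0 < (euclid_norm (grad phi x1))^-1.
    rewrite invr_gt0 /euclid_norm sqrtr_gt0; have [i ni] := n0.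
    rewrite (bigD1 i) //= ltr_wpDr ?sumr_ge0 // => [j _|]; first exact: sqr_ge0.
    by rewrite mxE lt0r sqrf_eq0 ni sqr_ge0.
  move: con; rewrite /conormal_derive nuE.
  have -> : \sum_i \sum_j aij i j x1 * pder_closure Omega j w x1 *
      ((euclid_norm (grad phi x1))^-1 *: grad phi x1) ord0 i =
     (euclid_norm (grad phi x1))^-1 * \sum_j q j * D j.
    rewrite exchange_big mulr_sumr; apply: eq_bigr => j _ /=.
    rewrite /q mulr_suml mulr_sumr; apply: eq_bigr => i _.
    rewrite !mxE -/(n i) -/(D j); ring.
  by rewrite pmulr_rge0.
pose v : 'rV[R]_d := \row_j - q j.
have phi1 : C1_at phi x1 by apply: C2_at_C1; exact: smooth_on_C2 oU sphi Ux1.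
have phi0 : phi x1 = 0 by exact: defining_function_boundary cx1 nOx1 dphi.
have [e1 e10 He1] : exists2 e : R, 0 < e & forall h, 0 < h < e -> phi (x1 + h *: v) < 0.
  have Dphi : is_derive (0 : R) 1 (fun s => phi (x1 + s *: v)) (- \sum_j q j * n j).
    apply: is_derive_eq; first by apply: C1_at_is_derive_line; rewrite scale0r addr0.
    rewrite scale0r addr0 -sumrN; apply: eq_bigr => j _.
    by rewrite mxE mulNr.
  have [|e e0 He] := is_derive_lt_right Dphi; first by rewrite oppr_lt0.
  by exists e => // h /He; rewrite add0r scale0r addr0 phi0.
have [e3 e30 He3] : exists2 e : R, 0 < e & forall h, `|h| < e -> Omega (x1 + h *: v) ->
   \sum_j v ord0 j * (pder j w (x1 + h *: v) + eps * pder j psi (x1 + h *: v)) < 0.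
  pose F := within Omega (nbhs x1).
  have FF : Filter F by exact: (within_filter Omega (nbhs_filter x1)).
  have cF : (fun y => \sum_j v ord0 j * (pder j w y + eps * pder j psi y)) @ F -->
      \sum_j v ord0 j * (D j + eps * n j).
    apply: cvg_fsum => j; apply: cvgMl_tmp; apply: cvg_axpy.
      exact: pder_closure_cvg.
    have cpsi : pder j psi y @[y --> x1] --> pder j psi x1.
      by have [_ h] := nbhs_singleton psi1; exact: h.
    rewrite /n -dpsi; apply: cvg_trans cpsi; apply: cvg_app; exact: cvg_within.
  have l0 : \sum_j v ord0 j * (D j + eps * n j) < 0.
    rewrite (_ : \sum_j _ = - (\sum_j q j * D j) - eps * \sum_j q j * n j); last first.
      rewrite mulr_sumr -opprD -big_split -sumrN; apply: eq_bigr => j _.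
      by rewrite mxE /=; ring.
    by rewrite -opprD oppr_lt0 ltr_wpDl // mulr_gt0.
  have nF : \forall y \near x1, Omega y ->
      \sum_j v ord0 j * (pder j w y + eps * pder j psi y) < 0.
    by have h := cvgr_lt _ cF 0 l0; rewrite near_withinE in h; exact: h.
  by have [e e0 He] := near_line v nF; exists e.
have nU : \forall y \near x1, U y by exact: open_nbhs_nbhs.
have [e2 e20 He2] := near_line v (filterI nU (filterI psi1 minw)).
pose s := Num.min e1 (Num.min e2 e3) / 2.
have mn0 : 0 < Num.min e1 (Num.min e2 e3) by rewrite !lt_min e10 e20.
have s0 : 0 < s by rewrite divr_gt0.
have : s < Num.min e1 (Num.min e2 e3) by rewrite /s ltr_pdivrMr // mulr2n mulrDr mulr1 ltrDl.
rewrite !lt_min => /and3P[se1 se2 se3].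
have inO h : 0 < h <= s -> Omega (x1 + h *: v).
  move=> /andP[h0 hs]; have [|Uh _] := He2 h; first by rewrite gtr0_norm // (le_lt_trans hs).
  by apply/(Uphi _ Uh)/He1; rewrite h0 (le_lt_trans hs).
have inC h : 0 <= h <= s -> closure Omega (x1 + h *: v).
  move=> /andP[]; rewrite le_eqVlt => /predU1P[<- _|h0 hs]; first by rewrite scale0r addr0.
  by apply: subset_closure; apply: inO; rewrite h0.
(* w is differentiable only inside Omega, that is for h > 0; at h = 0 continuity up to the boundary
   suffices for the mean value theorem. *)
have [||c cs] := @MVT R (fun h => w (x1 + h *: v) + eps * psi (x1 + h *: v))
   (fun h => \sum_j v ord0 j * (pder j w (x1 + h *: v) + eps * pder j psi (x1 + h *: v))) 0 s s0.
- move=> h; rewrite in_itv /= => /andP[h0 hs].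
  have hse : `|h| < e2 by rewrite gtr0_norm // (lt_trans hs).
  have Oh : Omega (x1 + h *: v) by apply: inO; rewrite h0 ltW.
  have cw : C1_at w (x1 + h *: v) := Ck_closure_C1 (s := [::]) oOmega w2 isT Oh.
  have [_ [cpsi _]] := He2 h hse.
  apply: (is_derive_eq (C1_at_is_derive_line (C1_at_axpy eps cw cpsi))).
  by apply: eq_bigr => j _; rewrite C1_at_pder_axpy.
- move=> h; apply: cvgD.
    by apply: (line_within_continuous _ inC); have [] := w2.
  apply: cvgMl_tmp; move: h; apply: derivable_within_continuous => h.
  rewrite in_itv /= => /andP[h0 hs].
  have [|_ [cpsi _]] := He2 h; first by rewrite ger0_norm // (le_lt_trans hs).
  by have [] := C1_at_is_derive_line cpsi.
rewrite in_itv /= in cs; have /andP[c0 c1] := cs.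
rewrite scale0r addr0 subr0 => E.
have [|_ [_ /(_ (inC s _))]] := He2 s; first by rewrite gtr0_norm.
rewrite (ltW s0) lexx => /(_ isT); rewrite -subr_ge0 E leNgt pmulr_llt0 // He3 //.
  by rewrite gtr0_norm // (lt_trans c1).
by apply: inO; rewrite c0 ltW.
Qed.
End conormal.

(** * Closed cubes and bounds for the operator on compact sets *)

Definition bounded_on (R : realType) (S : Type) (A : set S) (f : S -> R) :=
  exists M : R, forall z, A z -> `|f z| <= M.

Section bounded_on_theory.
Context (R : realType) (S : Type) (A : set S).
Implicit Types f g : S -> R.

Lemma bounded_onD f g : bounded_on A f -> bounded_on A g -> bounded_on A (fun z => f z + g z).
Proof.
move=> [M HM] [N HN]; exists (M + N) => z Az.
by apply: le_trans (ler_normD _ _) _; rewrite lerD ?HM ?HN.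
Qed.

Lemma bounded_onM f g : bounded_on A f -> bounded_on A g -> bounded_on A (fun z => f z * g z).
Proof.
move=> [M HM] [N HN]; exists (M * N) => z Az.
by rewrite normrM ler_pM ?HM ?HN.
Qed.

Lemma bounded_on_sum (I : finType) (f : I -> S -> R) :
  (forall i, bounded_on A (f i)) -> bounded_on A (fun z => \sum_i f i z).
Proof.
move=> /choice[M HM]; exists (\sum_i M i) => z Az.
by apply: le_trans (ler_norm_sum _ _ _) _; apply: ler_sum => i _; exact: HM.
Qed.

End bounded_on_theory.

Section cube.
Context (R : realType) (d : nat).
Implicit Types x y : 'rV[R]_d.

Definition cube x (r : R) : set 'rV[R]_d := [set y | forall i, `|x ord0 i - y ord0 i| <= r].

Lemma cube_compact x r : compact (cube x r).
Proof.
have -> : cube x r = [set v : 'rV[R]_d | forall i,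
    (fun i => `[x ord0 i - r, x ord0 i + r]%classic) i (v ord0 i)].
  apply/seteqP; split => y H i; have := H i; rewrite /= in_itv /= ler_distlC; lra.
apply: (@rV_compact _ _ (fun i => `[x ord0 i - r, x ord0 i + r]%classic)) => i.
exact: segment_compact.
Qed.

Lemma cube_nbhs x (U : set 'rV[R]_d) : nbhs x U ->
  exists2 r : R, 0 < r & cube x r `<=` U.
Proof.
move=> /nbhs_ballP[r0 /= r00 H]; exists (r0 / 2); first by rewrite divr_gt0.
move=> y yc; apply: H; apply/rV_ballP; split => // i.
by apply: le_lt_trans (yc i) _; rewrite ltr_pdivrMr // ltr_pMr // ltr1n.
Qed.

Lemma sqdist_ge0 x y : 0 <= sqdist x y.
Proof. by apply: sumr_ge0 => i _; exact: sqr_ge0. Qed.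

Lemma sqdist_eq0 x y : sqdist x y = 0 -> y = x.
Proof.
move=> /eqP; rewrite psumr_eq0; last by move=> i _; exact: sqr_ge0.
move=> /allP H; apply/rowP => i; have := H i (mem_index_enum _).
by rewrite sqrf_eq0 subr_eq0 => /eqP.
Qed.

Lemma sqdist_ge x y i : (y ord0 i - x ord0 i) ^+ 2 <= sqdist x y.
Proof. by rewrite /sqdist (bigD1 i) //= lerDl sumr_ge0 // => j _; exact: sqr_ge0. Qed.

End cube.

Section boundedness.
Context (R : realType) (d : nat).
Variable Omega : set 'rV[R]_d.
Hypothesis oOmega : open Omega.
Hypothesis cOmega : compact (closure Omega).
Variable T : R.
Variables (aij : 'I_d -> 'I_d -> 'rV[R]_d -> R) (b : 'I_d -> 'rV[R]_d -> R -> R).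
Hypothesis haC1 : forall i j, Ck_closure 1 Omega (aij i j).
Hypothesis hb : forall j, C0t_Ck T 2 Omega (b j).

(** A bound uniform in x and t lets eps be chosen before the perturbed minimum is located. *)
Lemma second_order_bounded (psi : 'rV[R]_d -> R) (K : set 'rV[R]_d) :
  compact K -> (forall x, K x -> C2_at psi x) ->
  exists M : R, forall x t, Omega x -> K x -> 0 <= t <= T ->
    `|second_order aij b psi x t| <= M.
Proof.
move=> cK psi2.
pose A := [set z : 'rV[R]_d * R | [/\ Omega z.1, K z.1 & 0 <= z.2 <= T]].
have bK (f : 'rV[R]_d -> R) : (forall x, K x -> {for x, continuous f}) ->
    bounded_on A (fun z => f z.1).
  move=> cf; have [|M _ HM] := @compact_continuous_bounded R _ K f cK.
    by apply: continuous_in_subspaceT => x /set_mem Kx; exact: cf.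
  by exists M => z [_ Kz _]; exact: HM.
have bO (f : 'rV[R]_d -> R) s : Ck_closure 1 Omega f -> (size s <= 1)%N ->
    bounded_on A (fun z => pders s f z.1).
  move=> f1 s1; have [M _ HM] := Ck_closure_bounded cOmega f1 s1.
  by exists M => z [Oz _ _]; exact: HM.
have bb j : bounded_on A (fun z => b j z.1 z.2).
  have cb := C0t_Ck_within_continuous oOmega cOmega (hb j).
  have [M _ HM] := compact_continuous_bounded
    (compact_setX cOmega (@segment_compact _ 0 T)) cb.
  exists M => z [Oz _ zT]; apply: HM; split; first exact: subset_closure.
  by rewrite /= in_itv.
have bpsi1 j : bounded_on A (fun z => pder j psi z.1).
  by apply: bK => x Kx; have [_ h] := C2_at_C1 (psi2 x Kx); exact: h.
have bpsi2 i j : bounded_on A (fun z => pder i (pder j psi) z.1).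
  by apply: bK => x Kx; have [_ h] := psi2 x Kx; have [_ h'] := h j; exact: h'.
have : bounded_on A (fun z => second_order aij b psi z.1 z.2).
  apply: bounded_onD; last by apply: bounded_on_sum => j; exact: bounded_onM.
  apply: bounded_on_sum => i; apply: bounded_on_sum => j; apply: bounded_onD.
    by apply: bounded_onM => //; exact: (bO (aij i j) [:: i]).
  by apply: bounded_onM => //; exact: (bO (aij i j) [::]).
by move=> [M HM]; exists M => x t Ox Kx tT; exact: (HM (x, t)).
Qed.

End boundedness.

(** * The minimum principle *)

Section maximum_principle.
Context (R : realType) (d : nat).
Local Notation mu := (@lebesgue_measure R).
Variable Omega : set 'rV[R]_d.
Hypothesis oOmega : open Omega.
Hypothesis cOmega : compact (closure Omega).
Variables (T : R) (T0 : 0 < T).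
Variables (aij : 'I_d -> 'I_d -> 'rV[R]_d -> R) (b : 'I_d -> 'rV[R]_d -> R -> R)
  (b0 : 'rV[R]_d -> R -> R).
Hypothesis haC1 : forall i j, Ck_closure 1 Omega (aij i j).
Hypothesis hasym : forall i j x, closure Omega x -> aij i j x = aij j i x.
Hypothesis haell : uniformly_elliptic Omega aij.
Hypothesis hb : forall j, C0t_Ck T 2 Omega (b j).
Hypothesis hb0 : C0t_Ck T 2 Omega b0.
Hypothesis b0_ge1 : forall x t, closure Omega x -> 0 <= t <= T -> 1 <= b0 x t.
Variables (alpha : R) (alpha01 : 0 < alpha < 1).
Variables (u : 'rV[R]_d -> R -> R) (hu : C0t_Ck T 2 Omega u).
Variable a : 'rV[R]_d -> R.
Hypothesis good : forall (x : 'rV[R]_d) (V : set 'rV[R]_d), Omega x -> nbhs x V ->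
    exists2 y, V y & Omega y /\ supersolution_at T aij b b0 alpha u a y.
Hypothesis hut : forall x t, closure Omega x -> 0 < t < T -> derivable (u x) t 1.

Lemma initial_ge0 x : closure Omega x -> 0 <= u x 0.
Proof.
have T0' : (0 : R) \in `[0, T] by rewrite in_itv /= lexx ltW.
have [u0 _] := hu T0'.
have inO y : Omega y -> 0 <= u y 0.
  move=> Oy; rewrite leNgt; apply/negP => uy.
  have cy : u z 0 @[z --> y] --> u y 0.
    exact: (Ck_closure_continuous (s := [::]) oOmega u0).
  have ny := cvgr_lt _ cy 0 uy.
  have [z zn [Oz sz]] := good Oy (ny (nbhs_filter y)).
  have := initial_value_ge0 oOmega cOmega T0 haC1 hb hb0 alpha01 hu Oz sz.
  by rewrite leNgt zn.
move=> cx; rewrite leNgt; apply/negP => ux.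
have e0 : 0 < - u x 0 / 2 by rewrite divr_gt0 // oppr_gt0.
have [cu _] := u0.
have [y [Oy _]] := closure_approx cu cx e0 (@filterT _ (nbhs x) _).
rewrite ler_distlC => /andP[_]; have := inO y Oy; lra.
Qed.

(** The time part gives A1 u >= 0 and the elliptic part gives A1 u <= b0 u + c * second_order g at
    the same point. For c = 0 this already contradicts u < 0; for c = eps it does so once eps is
    small. *)
Lemma min_interior (x0 : 'rV[R]_d) (t0 c : R) (g : 'rV[R]_d -> R) :
  Omega x0 -> 0 < t0 < T -> C2_at g x0 ->
  (\forall x \near x0, forall t, 0 <= t <= t0 -> u x0 t0 + c * g x0 <= u x t + c * g x) ->
  u x0 t0 < 0 -> 0 <= b0 x0 t0 * u x0 t0 + c * second_order aij b g x0 t0.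
Proof.
move=> Ox0 t0T g2 minx u0; have /andP[t00 t0T'] := t0T.
have tin : t0 \in `[0, T] by rewrite in_itv /= !ltW.
have [ut _] := hu tin.
have minx0 : \forall y \near x0, u x0 t0 + c * g x0 <= u y t0 + c * g y.
  by apply: filterS minx => y; apply; rewrite lexx ltW.
have le1 := A1_le_at_min oOmega b b0 haC1 hasym haell ut Ox0 g2 minx0.
apply: le_trans le1.
apply: (@no_negative_minimum _ _ _ oOmega cOmega T aij b b0 haC1 hb hb0 alpha alpha01 u hu a
  x0 t0 (fun y => c * g y)) => //.
  by apply: hut => //; exact: subset_closure.
have cg : {for x0, continuous g} by apply: C1_at_continuous; exact: C2_at_C1.
have cg' : g y @[y --> x0] --> g x0 by exact: cg.
exact: (@cvgMl_tmp _ _ (nbhs x0) _ _ c _ cg').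
Qed.


Variables (nu : 'rV[R]_d -> 'rV[R]_d) (sigma : 'rV[R]_d -> R).
Hypothesis hnu : outward_unit_normal Omega nu.
Hypothesis sigma_ge0 : forall x, boundary Omega x -> 0 <= sigma x.
Hypothesis hbd : forall x t, boundary Omega x -> 0 < t < T ->
  conormal_derive Omega nu aij (u^~ t) x + sigma x * u x t = 0.

(* Near a boundary minimum [x0], adding [eps * (phi + K |x - x0|^2)], with [phi]
   a defining function and [K] large, forces the minimum over a small cube to be
   interior, which the equation forbids, or to be [x0] itself, where the Robin
   condition becomes strict. *)
Lemma no_boundary_minimum (x0 : 'rV[R]_d) (t0 t1 : R) :
  closure Omega x0 -> ~ Omega x0 -> t1 < T -> 0 <= t0 <= t1 -> u x0 t0 < 0 ->
  (forall x t, closure Omega x -> 0 <= t <= t1 -> u x0 t0 <= u x t) -> False.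
Proof.
move=> cx0 nOx0 t1T t01 m0 minu; set m := u x0 t0 in m0 minu.
have bx0 : boundary Omega x0 by split => //; rewrite (proj1 (interior_id Omega) oOmega).
have [U [phi [dphi nuE]]] := hnu bx0; have [oU Ux0 sphi _ Uphi] := dphi.
have phi2 x : U x -> C2_at phi x by exact: smooth_on_C2 oU sphi.
have phi00 : phi x0 = 0 by exact: defining_function_boundary cx0 nOx0 dphi.
have [r' r'0 Hinc] := C1_at_increment (C2_at_C1 (phi2 x0 Ux0)) ltr01.
have nUr : nbhs x0 (U `&` ball x0 r').
  apply: (@filterI _ (nbhs x0) (nbhs_filter x0)); first exact: open_nbhs_nbhs.
  exact: nbhsx_ballx.
have [r r0 cubeU] := cube_nbhs nUr.
pose B := \sum_i (`|pder i phi x0| + 1).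
have B0 : 0 <= B by apply: sumr_ge0 => i _; rewrite addr_ge0.
have phiB x : cube x0 r x -> - (B * r) <= phi x.
  move=> cx; have [_ bx] := cubeU x cx.
  have := Hinc x0 x (ballxx _ r'0) bx; rewrite phi00 subr0 mul1r => h.
  have : `|phi x| <= B * r.
    rewrite -[phi x](subrK (\sum_i pder i phi x0 * (x ord0 i - x0 ord0 i))).
    apply: le_trans (ler_normD _ _) _; apply: le_trans (lerD h (ler_norm_sum _ _ _)) _.
    rewrite -big_split mulr_suml; apply: ler_sum => i _ /=.
    rewrite normrM -{1}[`|_ - _|]mul1r -mulrDl addrC.
    by apply: ler_wpM2l; [rewrite addr_ge0|rewrite distrC; exact: cx].
  by rewrite ler_norml => /andP[].
(* On the faces of the cube |x - x0|^2 >= r^2, so K |x - x0|^2 >= B r + 1 outweighs phi >= - B r. *)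
pose K := (B * r + 1) / r ^+ 2.
have K0 : 0 < K by rewrite divr_gt0 ?exprn_gt0 // ltr_wpDl // mulr_ge0 // ltW.
pose psi x := phi x + K * sqdist x0 x.
have psi2 x : cube x0 r x -> C2_at psi x.
  move=> /cubeU[Ux _]; have [] // := C2_at_axpy K (phi2 x Ux) (C2_at_sqdist x0 x).
have psi00 : psi x0 = 0.
  by rewrite /psi phi00 /sqdist big1 ?mulr0 ?addr0 // => i _; rewrite subrr expr0n.
have psi_sphere x i : cube x0 r x -> `|x0 ord0 i - x ord0 i| = r -> 0 < psi x.
  move=> cx xr; have := phiB x cx => h.
  have h2 : B * r + 1 <= K * sqdist x0 x.
    rewrite /K mulrAC ler_pdivlMr ?exprn_gt0 // ler_wpM2l //.
      by rewrite addr_ge0 // mulr_ge0 // ltW.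
    apply: le_trans (sqdist_ge x0 x i); rewrite -xr distrC.
    by rewrite real_normK ?num_real.
  rewrite /psi; lra.
have ccube : compact (cube x0 r) := @cube_compact _ _ x0 r.
have [Cpsi Cpsi0 HCpsi] : exists2 M : R, 0 < M & forall x, cube x0 r x -> `|psi x| <= M.
  apply: compact_continuous_bounded => //; apply: continuous_in_subspaceT => x /set_mem cx.
  by apply: C1_at_continuous; apply: C2_at_C1; exact: psi2.
have [M2 HM2] := second_order_bounded oOmega cOmega haC1 hb ccube psi2.
(* This makes eps * (Cpsi + |M2|) equal to half of - m: Cpsi bounds the change of the values, |M2|
   that of the operator. *)
pose eps := - m / (2 * (Cpsi + `|M2|)).
have den0 : 0 < Cpsi + `|M2| by rewrite ltr_wpDr.
have eps0 : 0 < eps by rewrite divr_gt0 ?oppr_gt0 // mulr_gt0.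
have epsE : eps * (Cpsi + `|M2|) = - m / 2 by rewrite /eps; field; exact: lt0r_neq0.
have epsC : eps * Cpsi + eps * `|M2| < - m by rewrite -mulrDr epsE; lra.
have epsM : 0 <= eps * `|M2| by rewrite mulr_ge0 // ltW.
pose N := cube x0 r `&` closure Omega.
have cN : compact N by apply: compact_closedI => //; exact: closed_closure.
have t10 : 0 <= t1 by case/andP: t01 => /le_trans; exact.
have x0N : N x0 by split => // i; rewrite subrr normr0 ltW.
have cv : {within N `*` `[0, t1], continuous (fun z : 'rV[R]_d * R => u z.1 z.2 + eps * psi z.1)}.
  have sN : N `*` `[0, t1] `<=` closure Omega `*` `[0, T].
    move=> [x t] [[_ cx] /=]; rewrite in_itv /= => /andP[h0 h1]; split => //.
    by rewrite /= in_itv /= h0 (le_trans h1) // ltW.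
  have cu := continuous_subspaceW sN (C0t_Ck_within_continuous oOmega cOmega hu).
  move=> z; apply: cvgD; first exact: cu.
  apply: cvgMl_tmp; move: z; apply: continuous_in_subspaceT => -[x t] /set_mem[[cx _] _].
  have cp : {for x, continuous psi}.
    by apply: C1_at_continuous; apply: C2_at_C1; exact: psi2.
  have cp' : psi y @[y --> x] --> psi x by exact: cp.
  exact: (cvg_comp _ _ (@cvg_fst _ _ (nbhs x) (nbhs t) _) cp').
have N0 : N `*` `[0, t1] !=set0 by exists (x0, t0); split => //=; rewrite in_itv.
have [[x2 t2] /set_mem[/= x2N]] := compact_EVT_min N0 (compact_setX cN (@segment_compact _ 0 t1)) cv.
rewrite in_itv /= => t2t Hmin; have [x2c x2O] := x2N.
have minv x t : N x -> 0 <= t <= t1 -> u x2 t2 + eps * psi x2 <= u x t + eps * psi x.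
  by move=> xN tt; apply: (Hmin (x, t)); rewrite inE; split => //=; rewrite in_itv.
have vm : u x2 t2 + eps * psi x2 <= m.
  by have := minv x0 t0 x0N t01; rewrite psi00 mulr0 addr0.
have epspsi : - (eps * Cpsi) <= eps * psi x2.
  have := HCpsi x2 x2c; rewrite ler_norml => /andP[h _].
  by rewrite -mulrN ler_wpM2l // ltW.
(* This margin, combined with b0 u <= u, beats the term eps * second_order psi in [min_interior]. *)
have u2 : u x2 t2 < - (eps * `|M2|) by lra.
have u20 : u x2 t2 < 0 by lra.
have t20 : 0 < t2.
  have /andP[] := t2t; rewrite le_eqVlt => /predU1P[t2E|//].
  by move: u20; rewrite -t2E ltNge initial_ge0.
have t2T : 0 < t2 < T by rewrite t20; case/andP: t2t => _ /le_lt_trans; exact.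
have t2T' : 0 <= t2 <= T by case/andP: t2T => /ltW -> /ltW ->.
have [Ox2|nOx2] := pselect (Omega x2).
  have x2b : ball x0 r x2.
    apply/rV_ballP; split => // i; rewrite lt_neqAle x2c andbT; apply/eqP => xr.
    have p0 := psi_sphere x2 i x2c xr.
    have := minu x2 t2 x2O t2t; rewrite leNgt => /negP; apply.
    by apply: lt_le_trans vm; rewrite ltrDl mulr_gt0.
  have : \forall x \near x2, forall t, 0 <= t <= t2 ->
      u x2 t2 + eps * psi x2 <= u x t + eps * psi x.
    have n1 : nbhs x2 (ball x0 r) by apply: open_nbhs_nbhs; split => //; exact: ball_open.
    have n2 := near_Omega oOmega Ox2.
    apply: filterS2 n1 n2 => x /rV_ballP[_ bx] Ox t /andP[tt1 tt2]; apply: minv.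
      by split; [move=> i; exact: ltW|exact: subset_closure].
    by rewrite tt1 (le_trans tt2) //; case/andP: t2t.
  move=> /(min_interior Ox2 t2T (psi2 x2 x2c)) /(_ u20); rewrite leNgt => /negP; apply.
  have h1 : b0 x2 t2 * u x2 t2 <= u x2 t2.
    by rewrite -[leRHS]mul1r ler_wnM2r ?(ltW u20) // b0_ge1.
  have h2 : eps * second_order aij b psi x2 t2 <= eps * `|M2|.
    rewrite ler_wpM2l ?(ltW eps0) //; apply: le_trans (ler_norm _) _.
    by apply: le_trans (HM2 x2 t2 Ox2 x2c t2T') _; exact: ler_norm.
  by apply: le_lt_trans (lerD h1 h2) _; rewrite -ltrBrDr sub0r.
have phi2ge : 0 <= phi x2.
  have [Ux2 _] := cubeU x2 x2c; rewrite leNgt; apply/negP => /(Uphi x2 Ux2); exact: nOx2.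
(* Minimality of m forces psi x2 <= 0, while phi >= 0 outside Omega, so the squared distance must
   vanish. The time t2 may still differ from t0. *)
have x20 : x2 = x0.
  apply: sqdist_eq0; apply/eqP; rewrite eq_le sqdist_ge0 andbT.
  have h1 := minu x2 t2 x2O t2t.
  have h2 : eps * psi x2 <= 0 by rewrite -(lerD2l (u x2 t2)) addr0; exact: le_trans h1.
  rewrite pmulr_rle0 // in h2.
  rewrite -(pmulr_rle0 _ K0); apply: le_trans h2; rewrite /psi lerDr //.
rewrite {x2N x2c x2O Hmin epspsi nOx2 phi2ge}x20 in minv vm u2 u20.
have t2in : t2 \in `[0, T] by rewrite in_itv.
have [ut _] := hu t2in.
have con : 0 <= conormal_derive Omega nu aij (u^~ t2) x0.
  have /eqP := hbd bx0 t2T; rewrite addr_eq0 => /eqP ->.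
  by rewrite -mulrN mulr_ge0 ?sigma_ge0 // oppr_ge0 ltW.
have nc : nbhs x0 (ball x0 r) by exact: nbhsx_ballx.
have H1 : \forall y \near x0, C1_at psi y.
  by apply: filterS nc => x /rV_ballP[_ bx]; apply: C2_at_C1; apply: psi2 => i; exact: ltW.
have H2 i : pder i psi x0 = pder i phi x0.
  rewrite C1_at_pder_axpy; last by apply: C2_at_C1; exact: C2_at_sqdist.
    by have [_ ->] := pder_sqdist x0 i x0; rewrite subrr !mulr0 addr0.
  by apply: C2_at_C1; exact: phi2.
have H3 : \forall y \near x0, closure Omega y ->
    u x0 t2 + eps * psi x0 <= u y t2 + eps * psi y.
  apply: filterS nc => x /rV_ballP[_ bx] Ox; apply: minv => //.
  by split => // i; exact: ltW.
exact: (boundary_no_min oOmega haC1 haell cx0 nOx0 dphi nuE ut con H1 H2 eps0 H3).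
Qed.

End maximum_principle.

Lemma bounded_closure_compact (R : realType) (d : nat) (A : set 'rV[R]_d) :
  bounded_set A -> compact (closure A).
Proof.
(* One unit because boundedness is stated for all numbers strictly above M, one for the distance
   from a closure point to A. *)
move=> [M [_ HM]]; pose K := M + 1 + 1.
have AK x i : A x -> `|x ord0 i| <= M + 1.
  move=> Ax; apply: le_trans (HM (M + 1) _ x Ax); last by rewrite ltrDl.
  rewrite [leRHS]/Num.Def.normr /= mx_normrE; apply/bigmax_geP; right => /=.
  by exists (ord0, i).
apply: (subclosed_compact (@closed_closure _ A) (@cube_compact _ _ 0 K)).
move=> x cx i; have [y [Ay /rV_ballP[_ bxy]]] := cx _ (nbhsx_ballx x _ ltr01).
rewrite mxE sub0r normrN -[x ord0 i](subrK (y ord0 i)).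
apply: le_trans (ler_normD _ _) _; rewrite addrC /K.
by apply: lerD; [exact: AK|exact: ltW].
Qed.

Theorem lemma3 (R : realType) (d : nat) (hd : (1 <= d <= 3)%N)
  (T : R) (hT : 0 < T)
  (Omega : set 'rV[R]_d) (hOmega : smooth_bounded_domain Omega)
  (nu : 'rV[R]_d -> 'rV[R]_d) (hnu : outward_unit_normal Omega nu)
  (sigma : 'rV[R]_d -> R) (hsigma : smooth_on_boundary Omega sigma)
  (hsigma0 : forall x, boundary Omega x -> 0 <= sigma x)
  (aij : 'I_d -> 'I_d -> 'rV[R]_d -> R)
  (haC1 : forall i j, Ck_closure 1 Omega (aij i j))
  (hasym : forall i j x, closure Omega x -> aij i j x = aij j i x)
  (haell : uniformly_elliptic Omega aij)
  (b : 'I_d -> 'rV[R]_d -> R -> R)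
  (hb : forall j, C1t_Ck T 1 Omega (b j) /\ C0t_Ck T 2 Omega (b j)) :
  exists2 M0 : R, 0 < M0 &
  forall (alpha : R) (halpha : 0 < alpha < 1)
    (b0 : 'rV[R]_d -> R -> R)
    (hb0 : C1t_Ck T 1 Omega b0 /\ C0t_Ck T 2 Omega b0)
    (hb0pos : forall x t, closure Omega x -> 0 <= t <= T -> 0 < b0 x t)
    (hb0min : forall x t, closure Omega x -> 0 <= t <= T -> M0 <= b0 x t)
    (F : 'rV[R]_d -> R -> R) (hF : L2t_L2 T Omega F)
    (a : 'rV[R]_d -> R) (ha : sobolev_H1 Omega a)
    (hFpos : {ae (lebesgue_rV R d \x lebesgue_measure)%E,
       forall z : 'rV[R]_d * R, Omega z.1 -> 0 < z.2 < T -> 0 <= F z.1 z.2})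
    (hapos : {ae lebesgue_rV R d, forall x, Omega x -> 0 <= a x})
    (u : 'rV[R]_d -> R -> R) (hu : C0t_Ck T 2 Omega u)
    (heq : {ae lebesgue_rV R d, forall x, Omega x ->
       exists2 w : R -> R, is_frac_derive alpha T (fun t => u x t - a x) w &
         {ae @lebesgue_measure R, forall t, 0 < t < T ->
            w t + A1 aij b b0 u x t = F x t}})
    (hbd : forall x t, boundary Omega x -> 0 < t < T ->
       conormal_derive Omega nu aij (u^~ t) x + sigma x * u x t = 0)
    (hinit : {ae lebesgue_rV R d, forall x, Omega x ->
       Halpha alpha T (fun t => u x t - a x)})
    (hut : forall x t, closure Omega x -> 0 < t < T -> derivable (u x) t 1)
    (hutC : exists2 w : 'rV[R]_d -> R -> R, C0t_Ck T 0 Omega w &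
       forall x t, closure Omega x -> 0 < t < T ->
         w x t = t `^ (1 - alpha) * derive1 (u x) t),
  forall x t, Omega x -> 0 < t < T -> 0 <= u x t.
Proof.
have [On0 oO cnO bO _] := hOmega.
have cO := bounded_closure_compact bO.
exists 1; first exact: ltr01.
move=> alpha halpha b0 hb0 hb0pos hb0min F hF a ha hFpos hapos u hu heq hbd hinit hut hutC.
move=> x t Ox /andP[t0 tT]; rewrite leNgt; apply/negP => uxt.
have hb' j : C0t_Ck T 2 Omega (b j) by have [_] := hb j.
have [_ hb0'] := hb0.
have hF' := ae_product hFpos.
have sol : {ae lebesgue_rV R d, forall x, Omega x -> supersolution_at T aij b b0 alpha u a x}.
  have FF := ae_filter_ringOfSetsType (lebesgue_rV R d).
  have A1 := @filterI _ _ FF _ _ hapos (@filterI _ _ FF _ _ hF' heq).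
  apply: (@filterS _ _ FF _ _ _ A1) => y [ay [Fy hy]] Oy.
  have [w [_ w2 wE] wA] := hy Oy; split; first exact: ay.
  exists w; split => //.
  have FF' := ae_filter_ringOfSetsType (@lebesgue_measure R : {measure set (measurableTypeR R) -> \bar R}).
  have A2 := @filterI _ _ FF' _ _ wA Fy.
  apply: (@filterS _ _ FF' _ _ _ A2) => s [h1 h2] sT.
  by rewrite h1 // h2.
have good (y : 'rV[R]_d) (V : set 'rV[R]_d) : Omega y -> nbhs y V ->
    exists2 z, V z & Omega z /\ supersolution_at T aij b b0 alpha u a z.
  move=> Oy nV; have nVO := @filterI _ (nbhs y) (nbhs_filter y) _ _ nV (near_Omega oO Oy).
  by have [z [Vz Oz] sz] := ae_lebesgue_rV_dense sol nVO; exists z => //; split => //; exact: sz.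
have cx : closure Omega x by exact: subset_closure.
(* The minimum is taken up to the time t < T of the supposed negative value, which stays below the
   final time. *)
have cu : {within closure Omega `*` `[0, t], continuous (fun z : 'rV[R]_d * R => u z.1 z.2)}.
  apply: continuous_subspaceW (C0t_Ck_within_continuous oO cO hu).
  move=> [y s] /= [cy]; rewrite in_itv /= => /andP[s0 st]; split => //=.
  by rewrite in_itv /= s0 (le_trans st) // ltW.
have n0 : closure Omega `*` `[0, t] !=set0.
  by exists (x, t); split => //=; rewrite in_itv /= lexx ltW.
have [[x0 s0] /set_mem[/= cx0]] := compact_EVT_min n0 (compact_setX cO (@segment_compact _ 0 t)) cu.
rewrite in_itv /= => s0t Hmin.
have minu y s : closure Omega y -> 0 <= s <= t -> u x0 s0 <= u y s.
  by move=> cy st; apply: (Hmin (y, s)); rewrite inE; split => //=; rewrite in_itv.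
have m0 : u x0 s0 < 0 by apply: le_lt_trans uxt; apply: minu; rewrite // lexx ltW.
have b01 y s : closure Omega y -> 0 <= s <= T -> 1 <= b0 y s by exact: hb0min.
have [Ox0|nOx0] := pselect (Omega x0).
  have s00 : 0 < s0.
    have /andP[] := s0t; rewrite le_eqVlt => /predU1P[sE|//].
    have u0 := initial_ge0 oO cO hT haC1 hb' hb0' halpha hu good cx0.
    by move: m0; rewrite -sE ltNge u0.
  have s0T : 0 < s0 < T by rewrite s00; case/andP: s0t => _ /le_lt_trans; exact.
  have nmin : \forall y \near x0, forall s, 0 <= s <= s0 ->
      u x0 s0 + 0 * sqdist x0 x0 <= u y s + 0 * sqdist x0 y.
    apply: filterS (near_Omega oO Ox0) => y Oy s /andP[h0 h1].
    rewrite !mul0r !addr0; apply: minu; first exact: subset_closure.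
    by rewrite h0 (le_trans h1) //; case/andP: s0t.
  (* At an interior minimum no perturbation is required: c = 0, with the squared distance as an
     arbitrary C^2 function. *)
  have := @min_interior R d Omega oO cO T aij b b0 haC1 hasym haell hb' hb0' alpha halpha u hu a
    good hut x0 s0 0 (sqdist x0) Ox0 s0T (C2_at_sqdist x0 x0) nmin m0.
  rewrite mul0r addr0 => H.
  have b00 : 0 < b0 x0 s0.
    apply: lt_le_trans (b01 x0 s0 cx0 _) => //.
    by case/andP: s0T => /ltW -> /ltW ->.
  by rewrite pmulr_rge0 // leNgt m0 in H.
exact: (@no_boundary_minimum R d Omega oO cO T hT aij b b0 haC1 hasym haell hb' hb0' b01
  alpha halpha u hu a good hut nu sigma hnu hsigma0 hbd x0 s0 t cx0 nOx0 tT s0t m0 minu).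
Qed.
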